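(* Let $q=p^e$ be a power of an odd prime $p$ with $q\equiv 1\pmod 4$, let $t=\frac{q-1}{4}$, and let $T$ be a generator of the character group $\widehat{\mathbb F_q^{\times}}$. Let $\lambda\in\mathbb F_q^{\times}$. Then \begin{align*} \#X_{\lambda}^4(\mathbb F_q)&=\frac{q^3-1}{q-1}+12q\,T^t(-1)\,T^{2t}(1-\lambda^4)\\ &\quad+q^2\,{}_{3}F_{2}\left(\left.\begin{array}{ccc} T^t&T^{2t}&T^{3t}\\ {} &\epsilon&\epsilon\end{array}\right|\frac{1}{\lambda^4}\right)_q+3q^2\binom{T^{3t}}{T^t}\,{}_{2}F_{1}\left(\left.\begin{array}{cc} T^{3t}&T^{t}\\ {} &T^{2t}\end{array}\right|\frac{1}{\lambda^4}\right)_q . \end{align*} In particular, when $\lambda^4=1$, $$\#X_{\lambda}^4(\mathbb F_q)=\frac{q^3-1}{q-1}+3q\,T^t(-1)+q^2\,{}_{3}F_{2}\left(\left.\begin{array}{ccc} T^t&T^{2t}&T^{3t}\\ {} &\epsilon&\epsilon\end{array}\right|1\right)_q.$$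
   Context: For $\lambda\in\mathbb F_q$, $X_\lambda^4$ is the Dwork K3 surface in $\mathbb P^3$ defined by $x_1^4+x_2^4+x_3^4+x_4^4=4\lambda x_1x_2x_3x_4$, and $\#X_\lambda^4(\mathbb F_q)$ is its number of $\mathbb F_q$-rational points in $\mathbb P^3$. Every multiplicative character $\chi$ of $\mathbb F_q^\times$ (including the trivial character $\epsilon$) is extended to $\mathbb F_q$ by $\chi(0)=0$; $\overline\chi$ denotes the inverse character. For characters $A,B$, the normalized Jacobi sum is $\binom{A}{B}:=\frac{B(-1)}{q}\sum_{x\in\mathbb F_q}A(x)\overline B(1-x)$. Greene's finite field hypergeometric function is $${}_{n+1}F_{n}\left(\left.\begin{array}{cccc} A_0&A_1&\ldots&A_n\\ {}&B_1&\ldots&B_n\end{array}\right|x\right)_q:=\frac{q}{q-1}\sum_{\chi}\binom{A_0\chi}{\chi}\binom{A_1\chi}{B_1\chi}\cdots\binom{A_n\chi}{B_n\chi}\chi(x),$$ the sum over all multiplicative characters $\chi$ of $\mathbb F_q^\times$. *)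

(* Defs.v *)
From HB Require Import structures.
From mathcomp Require Import all_boot all_order all_algebra all_fingroup
  all_solvable all_field all_character.
Set Implicit Arguments. Unset Strict Implicit. Unset Printing Implicit Defensive.
Import GRing.Theory Num.Theory.
Local Open Scope ring_scope.

Definition UG (F : finFieldType) : {group {unit F}} := [set: {unit F}]%G.

(* Multiplicative characters of F_q^x are the (linear) irreducible characters
   'chi_i, i : Iirr (UG F), of the abelian group F_q^x; products of characters
   are products in 'CF(UG F), the trivial character epsilon is 1 = 'chi_0.
   [cext chi] is chi extended to F by chi(0) = 0. *)
Definition cext (F : finFieldType) (chi : 'CF(UG F)) (x : F) : algC :=
  oapp (fun u : {unit F} => chi u) 0 (insub x : option {unit F}).

(* Inverse character, extended by 0 at 0 (values are inverted pointwise,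
   0^-1 = 0 in algC). *)
Definition cinv (F : finFieldType) (chi : 'CF(UG F)) (x : F) : algC :=
  (cext chi x)^-1.

Definition jacobi (F : finFieldType) (A B : 'CF(UG F)) : algC :=
  cext B (-1) / (#|F|%:R) * \sum_(x : F) cext A x * cinv B (1 - x).

Definition greene21 (F : finFieldType) (A0 A1 B1 : 'CF(UG F)) (x : F) : algC :=
  (#|F|%:R / (#|F|.-1)%:R) *
  \sum_(i : Iirr (UG F))
     jacobi (A0 * 'chi_i) 'chi_i * jacobi (A1 * 'chi_i) (B1 * 'chi_i)
     * cext 'chi_i x.

Definition greene32 (F : finFieldType) (A0 A1 A2 B1 B2 : 'CF(UG F)) (x : F)
  : algC :=
  (#|F|%:R / (#|F|.-1)%:R) *
  \sum_(i : Iirr (UG F))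
     jacobi (A0 * 'chi_i) 'chi_i * jacobi (A1 * 'chi_i) (B1 * 'chi_i)
     * jacobi (A2 * 'chi_i) (B2 * 'chi_i) * cext 'chi_i x.

(* Points of P^3(F), each represented by its unique normalized coordinate
   vector: the first nonzero coordinate equals 1. *)
Definition normalized (F : finFieldType) (x : {ffun 'I_4 -> F}) : bool :=
  [exists i : 'I_4, (x i == 1) && [forall j : 'I_4, (j < i)%N ==> (x j == 0)]].

Definition dwork_count (F : finFieldType) (lam : F) : nat :=
  #|[set x : {ffun 'I_4 -> F} | normalized x &
      \sum_(i < 4) x i ^+ 4 == 4%:R * lam * \prod_(i < 4) x i]|.

(* Main.v *)
Require Import Defs.
From HB Require Import structures.
From mathcomp Require Import all_boot all_order all_algebra all_fingroup
  all_solvable all_field all_character.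
From mathcomp Require Import ring.
Set Implicit Arguments. Unset Strict Implicit. Unset Printing Implicit Defensive.
Import GRing.Theory Num.Theory.
Local Open Scope ring_scope.

(** Split the surface by the number of vanishing coordinates.  On the torus,
put x_1 = 1 and replace x_4 by the product P of the coordinates: the equation
then depends on x_2, x_3 only through their fourth powers, and summing over
the 16 pairs of characters of order dividing 4 reduces the count to sums over
256 lam^4 u v w = (1 + u + v + w)^4.  Their Fourier coefficient at a character
chi is a quotient g(chi) g(chi eta^a) g(chi eta^b) g(chi eta^(-a-b)) / g(chi^4)
of Gauss sums, with eta = T^t, which the Hasse-Davenport relation for chi^4
turns into a product of Jacobi sums.  Up to shifting chi by a power of eta,
only three exponent patterns occur: (0,0,0,0) once, giving the 3F2;
(0,0,2,2) three times, giving the 2F1; and (0,0,1,3) twelve times, giving a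
sum which collapses to q T^t(-1) T^2t(1 - lam^4).  The identification fails
only at the four characters with chi^4 = 1; their contribution does not depend
on lam and combines with the strata where a coordinate vanishes to
q^2 + q + 1. *)

(** * Gauss and Jacobi sums for a cyclic family of characters *)

Section GaussSums.

(** [X k] models T^k, so characters are written additively in ['Z_n] with n = q - 1. The hypotheses
    are the orthogonality relations of the full character group and the properties of a nontrivial
    additive character [psi]. *)
Variables (F : finFieldType) (n : nat) (X : 'Z_n -> F -> algC) (psi : F -> algC).
Hypothesis card_F : #|F| = n.+1.
Hypothesis n_gt1 : (1 < n)%N.
Hypothesis chi0 : forall k, X k 0 = 0.
Hypothesis chi1 : forall k, X k 1 = 1.
Hypothesis chiM : forall k x y, X k (x * y) = X k x * X k y.
Hypothesis chiD : forall k l x, X (k + l) x = X k x * X l x.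
Hypothesis triv_chi : forall x, x != 0 -> X 0 x = 1.
Hypothesis sum_chi : forall k, \sum_x X k x = (if k == 0 then n%:R else 0).
Hypothesis sum_dual : forall x, \sum_k X k x = (if x == 1 then n%:R else 0).
Hypothesis psiD : forall x y, psi (x + y) = psi x * psi y.
Hypothesis psi0 : psi 0 = 1.
Hypothesis sum_psi : forall z,
  \sum_x psi (z * x) = (if z == 0 then #|F|%:R else 0).

Local Notation q := (#|F|%:R : algC).
Local Notation N := (n%:R : algC).

Definition gauss k := \sum_x X k x * psi x.
Definition jac k l := \sum_x X k x * X l (1 - x).

Local Notation G := gauss.
Local Notation J := jac.

Lemma qE : q = N + 1.
Proof. by rewrite card_F -natr1. Qed.

Lemma q_neq0 : q != 0.
Proof. by rewrite card_F pnatr_eq0. Qed.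

Lemma N_neq0 : N != 0.
Proof. by rewrite pnatr_eq0 -lt0n ltnW. Qed.

Lemma chiX k x m : X k (x ^+ m.+1) = X (k *+ m.+1) x.
Proof.
elim: m => [//|m IH].
by rewrite exprS chiM IH [in RHS]mulrS chiD.
Qed.

Lemma chi_neq0 k x : x != 0 -> X k x != 0.
Proof.
move=> x0; apply/eqP => e; have := chi1 k.
by rewrite -(divff x0) chiM e mul0r => /esym/eqP; rewrite oner_eq0.
Qed.

Lemma chiNK k x : x != 0 -> X k x * X (- k) x = 1.
Proof. by move=> x0; rewrite -chiD subrr triv_chi. Qed.

Lemma chiV k x : X k x^-1 = X (- k) x.
Proof.
have [->|x0] := eqVneq x 0; first by rewrite invr0 !chi0.
by apply: (mulfI (chi_neq0 k x0)); rewrite -chiM divff // chi1 chiNK.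
Qed.

Lemma chiN1 k : X k (-1) * X k (-1) = 1.
Proof. by rewrite -chiM mulrNN mulr1 chi1. Qed.

Lemma chiN1N k : X (- k) (-1) = X k (-1).
Proof. by rewrite -chiV invrN invr1. Qed.

Lemma chi_opp k x : X k (- x) = X k (-1) * X k x.
Proof. by rewrite -chiM mulN1r. Qed.

Lemma dual_orth x y : y != 0 ->
  \sum_k X k x * X (- k) y = if x == y then N else 0.
Proof.
move=> y0; under eq_bigr => k _ do rewrite -chiV -chiM.
by rewrite sum_dual -(inj_eq (mulIf y0)) mul1r mulfVK.
Qed.

(** Even the trivial character vanishes at 0, so [X 0] is the indicator function of the nonzero
    elements. *)
Lemma sum_nz (h : F -> algC) : \sum_(x | x != 0) h x = \sum_x X 0 x * h x.
Proof.
rewrite [RHS](bigD1 (0 : F)) //= chi0 mul0r add0r.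
by apply: eq_bigr => x x0; rewrite triv_chi // mul1r.
Qed.

Lemma gauss0 : G 0 = -1.
Proof.
rewrite /gauss -sum_nz; have := sum_psi 1; rewrite oner_eq0.
under eq_bigr => x _ do rewrite mul1r.
by rewrite (bigD1 (0 : F)) //= psi0 => /eqP; rewrite addrC addr_eq0 => /eqP.
Qed.

Lemma gauss_scale k z : z != 0 -> \sum_x X k x * psi (z * x) = X (- k) z * G k.
Proof.
move=> z0; rewrite /gauss big_distrr /= [RHS](reindex_inj (mulfI z0)) /=.
by apply: eq_bigr => x _; rewrite chiM !mulrA [_ * X k z]mulrC chiNK // mul1r.
Qed.

Lemma gauss_scale_neq0 k z : k != 0 ->
  \sum_x X k x * psi (z * x) = X (- k) z * G k.
Proof.
move=> k0; have [->|] := eqVneq z 0; last exact: gauss_scale.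
under eq_bigr => x _ do rewrite mul0r psi0 mulr1.
by rewrite sum_chi (negPf k0) chi0 mul0r.
Qed.

(** Expanding [G (- k)] over y and absorbing [X (- k) y] into [G k] by scaling leaves, for each x,
    the sum of psi(y(1 + x)) over y != 0. It is q - 1 at x = -1 and -1 elsewhere; the constant -1
    disappears because the sum of [X k] is 0. *)
Lemma gaussN k : k != 0 -> G k * G (- k) = X k (-1) * q.
Proof.
move=> k0; rewrite {2}/gauss big_distrr /=.
transitivity (\sum_y X 0 y * (\sum_x X k x * psi (y * (1 + x)))).
  apply: eq_bigr => y _; have [->|y0] := eqVneq y 0.
    by rewrite !chi0 !mul0r mulr0.
  rewrite triv_chi // mul1r mulrA [G k * _]mulrC -(gauss_scale k y0) mulr_suml.
  by apply: eq_bigr => x _; rewrite -mulrA mulrDr mulr1 psiD [psi y * _]mulrC.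
rewrite -sum_nz exchange_big /=.
transitivity (\sum_x X k x * ((if x == -1 then q else 0) - 1)).
  apply: eq_bigr => x _; rewrite -mulr_sumr; congr (_ * _).
  have := sum_psi (1 + x); rewrite (bigD1 (0 : F)) //= mulr0 psi0 addrC.
  rewrite addrC addr_eq0 eq_sym eqr_oppLR => <-; rewrite addrAC subrr add0r.
  by apply: eq_bigr => y _; rewrite mulrC.
under eq_bigr => x _ do rewrite mulrDr mulrN1.
rewrite big_split /= sumrN sum_chi (negPf k0) subr0.
rewrite (bigD1 (-1)) //= eqxx big1 ?addr0 // => x /negPf ->.
by rewrite mulr0.
Qed.

Lemma gauss_neq0 k : G k != 0.
Proof.
have [->|k0] := eqVneq k 0; first by rewrite gauss0 oppr_eq0 oner_eq0.
have := gaussN k0; apply: contra_eq_neq => ->.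
by rewrite mul0r eq_sym mulf_neq0 ?q_neq0 // chi_neq0 // oppr_eq0 oner_eq0.
Qed.

(** The double sum is grouped by s = x + y. The part s = 0 is a full sum of the nontrivial character
    [X (k + l)], hence 0; for s != 0, scaling x by s produces [X (k + l) s] times the Jacobi sum. *)
Lemma jac_gauss k l : k + l != 0 -> G k * G l = J k l * G (k + l).
Proof.
move=> kl0.
transitivity (\sum_s (\sum_x X k x * X l (s - x)) * psi s).
  rewrite {1}/gauss mulr_suml.
  under [RHS]eq_bigr => s _ do rewrite mulr_suml.
  rewrite exchange_big /=; apply: eq_bigr => x _.
  rewrite /gauss mulr_sumr [RHS](reindex_inj (addIr x)) /=.
  apply: eq_bigr => y _; rewrite addrK psiD; ring.
rewrite {1}/gauss mulr_sumr; apply: eq_bigr => s _.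
have [->|s0] := eqVneq s 0.
  rewrite chi0 mul0r mulr0.
  under eq_bigr => x _ do rewrite sub0r chi_opp mulrCA -chiD.
  by rewrite -mulr_sumr sum_chi (negPf kl0) mulr0 mul0r.
rewrite mulrA; congr (_ * _).
rewrite /jac mulr_suml (reindex_inj (mulfI s0)) /=.
by apply: eq_bigr => x _; rewrite -{2}(mulr1 s) -mulrBr !chiM chiD; ring.
Qed.

Lemma jacE k l : k + l != 0 -> J k l = G k * G l / G (k + l).
Proof. by move=> kl; rewrite jac_gauss // mulfK // gauss_neq0. Qed.

(** The map x -> x / (1 - x) carries the elements other than 1 bijectively to those other than -1,
    so the sum is a full character sum with the term at -1 missing. *)
Lemma jacN k : k != 0 -> J k (- k) = - X k (-1).
Proof.
move=> k0; rewrite /jac.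
transitivity (\sum_y X k y - X k (-1)).
  rewrite (bigD1 (-1 : F) (F := X k)) //= [RHS]addrC [RHS]addKr.
  rewrite (bigD1 (1 : F)) //= subrr chi0 mulr0 add0r.
  transitivity (\sum_(x | x != 1) X k (x / (1 - x))).
    by apply: eq_bigr => x _; rewrite chiM chiV.
  rewrite [RHS](reindex_onto (fun x => x / (1 - x)) (fun y => y / (1 + y))) /=.
    apply: eq_bigl => x; have [->|x1] := eqVneq x 1.
      rewrite subrr invr0 mulr0 mul0r [0 == 1]eq_sym oner_eq0 andbF.
      by [].
    have d0 : 1 - x != 0 by rewrite subr_eq0 eq_sym.
    have -> : 1 + x / (1 - x) = (1 - x)^-1 by field.
    rewrite invrK mulfVK // eqxx andbT.
    rewrite -(inj_eq (mulIf d0)) mulfVK // -subr_eq0.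
    have -> : x - -1 * (1 - x) = 1 by ring.
    by rewrite oner_eq0.
  move=> y y1; have d0 : 1 + y != 0 by rewrite addrC addr_eq0.
  field; rewrite d0 /=.
  have -> : 1 + y - y = 1 by ring.
  by rewrite oner_eq0.
by rewrite sum_chi (negPf k0) sub0r.
Qed.

Lemma jac00 : J 0 0 = q - 2%:R.
Proof.
rewrite /jac -sum_nz (bigD1 (1 : F)) ?oner_eq0 //= subrr chi0 add0r.
under eq_bigr => x /andP[_ x1] do rewrite triv_chi ?subr_eq0 1?eq_sym //.
have := sum_chi 0; rewrite eqxx (bigD1 (0 : F)) //= chi0 add0r.
rewrite (bigD1 (1 : F)) ?oner_eq0 //= chi1 => e.
have -> : q - 2%:R = N - 1 by rewrite qE; ring.
rewrite -e [RHS]addrC [RHS]addKr; apply: eq_bigr => x /andP[x0 _].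
by rewrite triv_chi.
Qed.

(* The four-variable Jacobi-type sum; when D = 0, the factor X D only
   restricts the sum to 1 + u + v + w != 0. *)
Definition jac4 A B C D :=
  \sum_u \sum_v \sum_w X A u * X B v * X C w * X D (1 + u + v + w).

(** With z outermost the sum factors into Gauss sums. Summing over z first instead gives [jac4],
    which is how both evaluations below use it. *)
Lemma gauss_jac4 A B C D :
  \sum_u \sum_v \sum_w \sum_z
    X A u * X B v * X C w * (X D z * psi (z * (1 + u + v + w)))
  = G A * G B * G C * G (D - A - B - C).
Proof.
transitivity (\sum_z (\sum_u X A u * psi (z * u)) * ((\sum_v X B v * psi (z * v))
   * ((\sum_w X C w * psi (z * w)) * (X D z * psi z)))).
  under eq_bigr => u _ do under eq_bigr => v _ do rewrite exchange_big /=.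
  under eq_bigr => u _ do rewrite exchange_big /=.
  rewrite exchange_big /=; apply: eq_bigr => z _.
  rewrite mulr_suml; apply: eq_bigr => u _.
  rewrite mulr_suml mulr_sumr; apply: eq_bigr => v _.
  rewrite mulr_suml !mulr_sumr; apply: eq_bigr => w _.
  by rewrite !mulrDr mulr1 !psiD; ring.
rewrite {4}/gauss mulr_sumr; apply: eq_bigr => z _.
have [->|z0] := eqVneq z 0; first by rewrite !chi0; ring.
by rewrite !gauss_scale // !chiD; ring.
Qed.

Lemma jac4E A B C D : D != 0 ->
  jac4 A B C D = G A * G B * G C * G (- (A + B + C + D)) / G (- D).
Proof.
move=> D0; apply: (mulIf (gauss_neq0 (- D))); rewrite mulfVK ?gauss_neq0 //.
have -> : - (A + B + C + D) = - D - A - B - C by ring.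
rewrite -gauss_jac4 /jac4 mulr_suml; apply: eq_bigr => u _.
rewrite mulr_suml; apply: eq_bigr => v _; rewrite mulr_suml; apply: eq_bigr => w _.
under eq_bigr => z _ do rewrite [z * _]mulrC.
by rewrite -mulr_sumr gauss_scale_neq0 ?oppr_eq0 // opprK mulrA.
Qed.

(** For s = 1 + u + v + w, the indicator of s != 0 times q equals N minus the sum of psi(zs) over z
    != 0. The constant N contributes a product of three full character sums, nonzero only for three
    trivial characters. *)
Lemma jac4E0 A B C :
  jac4 A B C 0 = ((if (A == 0) && (B == 0) && (C == 0) then N ^+ 4 else 0)
                  - G A * G B * G C * G (- (A + B + C))) / q.
Proof.
apply: (mulIf q_neq0); rewrite mulfVK ?q_neq0 //.
have -> : - (A + B + C) = 0 - A - B - C by ring.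
rewrite -gauss_jac4.
transitivity (\sum_u \sum_v \sum_w (X A u * X B v * X C w * N
   - \sum_z X A u * X B v * X C w * (X 0 z * psi (z * (1 + u + v + w))))).
  rewrite /jac4 mulr_suml; apply: eq_bigr => u _.
  rewrite mulr_suml; apply: eq_bigr => v _; rewrite mulr_suml; apply: eq_bigr => w _.
  rewrite -mulr_sumr -mulrBr -[LHS]mulrA; congr (_ * _).
  set s := 1 + u + v + w.
  have := sum_psi s; rewrite (bigD1 (0 : F)) //= mulr0 psi0 sum_nz => e.
  under eq_bigr => z _ do rewrite [z * s]mulrC.
  have [s0|s0] := eqVneq s 0; move: e; last first.
    rewrite (negPf s0) triv_chi // => /eqP; rewrite addrC addr_eq0 => /eqP ->.
    by rewrite qE; ring.
  rewrite s0 eqxx chi0 mul0r => /(canRL (addKr _)) ->; rewrite qE; ring.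
under eq_bigr => u _ do under eq_bigr => v _ do rewrite sumrB.
under eq_bigr => u _ do rewrite sumrB.
rewrite sumrB; congr (_ - _).
transitivity ((\sum_u X A u) * (\sum_v X B v) * (\sum_w X C w) * N).
  rewrite -!mulrA mulr_suml; apply: eq_bigr => u _.
  rewrite mulr_suml mulr_sumr; apply: eq_bigr => v _.
  rewrite mulr_suml !mulr_sumr; apply: eq_bigr => w _; ring.
rewrite !sum_chi; do 3 case: eqP => _ /=; ring.
Qed.

Lemma jacC k l : J k l = J l k.
Proof.
rewrite /jac (reindex_inj (subrI (1 : F))) /=.
by apply: eq_bigr => x _; rewrite subKr mulrC.
Qed.

Lemma jac0 k : k != 0 -> J 0 k = -1.
Proof. by move=> k0; rewrite jacE add0r // mulfK ?gauss_neq0 // gauss0. Qed.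

(** Orthogonality over k detects the equation, and summing over y first leaves only the k killed by
    [m.+1]. *)
Lemma card_roots m u : u != 0 ->
  \sum_(y | y != 0) (y ^+ m.+1 == u)%:R = \sum_(k | k *+ m.+1 == 0) X k u.
Proof.
move=> u0; apply: (mulfI N_neq0); rewrite !mulr_sumr.
transitivity (\sum_(y | y != 0) \sum_k X k u * X (- k) (y ^+ m.+1)).
  apply: eq_bigr => y y0; rewrite dual_orth ?expf_neq0 // eq_sym.
  by case: eqP; rewrite ?mulr1 ?mulr0.
rewrite exchange_big [RHS]big_mkcond /=; apply: eq_bigr => k _.
rewrite -mulr_sumr sum_nz.
under eq_bigr => y _ do rewrite chiX -chiD add0r mulNrn.
rewrite sum_chi oppr_eq0; case: eqP; by rewrite ?mulr0 // mulrC.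
Qed.

Lemma sum_powers m (f : F -> algC) :
  \sum_(y | y != 0) f (y ^+ m.+1) = \sum_u (\sum_(k | k *+ m.+1 == 0) X k u) * f u.
Proof.
transitivity (\sum_(y | y != 0) \sum_(u | u != 0) (y ^+ m.+1 == u)%:R * f u).
  apply: eq_bigr => y y0; rewrite (bigD1 (y ^+ m.+1)) ?expf_neq0 //= eqxx mul1r.
  by rewrite big1 ?addr0 // => u /andP[_]; rewrite eq_sym => /negPf ->; rewrite mul0r.
rewrite exchange_big /= [RHS](bigD1 (0 : F)) //= [X in _ = X * _ + _]big1 //.
rewrite mul0r add0r; apply: eq_bigr => u u0.
by rewrite -mulr_suml card_roots.
Qed.

(** * Characters of order dividing 4 and the Hasse-Davenport relations *)

Variable t : 'Z_n.
Hypothesis t4 : t *+ 4 = 0.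
Hypothesis t2_neq0 : t *+ 2 != 0.
Hypothesis torsion4 : forall k, k *+ 4 = 0 -> k \in [:: 0; t; t *+ 2; t *+ 3].
Hypothesis two_neq0 : (2%:R : F) != 0.

Lemma t_neq0 : t != 0.
Proof. by apply: contraNneq t2_neq0 => ->; rewrite mul0rn. Qed.

Lemma t3E : t *+ 3 = - t.
Proof. by apply/eqP; rewrite -addr_eq0 -mulrSr t4. Qed.

Lemma t2N : - (t *+ 2) = t *+ 2.
Proof. by apply/eqP; rewrite eq_sym -addr_eq0 -mulrnDr t4. Qed.

Lemma t3_neq0 : t *+ 3 != 0.
Proof. by rewrite t3E oppr_eq0 t_neq0. Qed.

Lemma four_neq0 : (4%:R : F) != 0.
Proof. by rewrite -[4%N]/(2 * 2)%N natrM mulf_neq0. Qed.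

Lemma c256_neq0 : (256%:R : F) != 0.
Proof. by rewrite -[256%N]/(4 ^ 4)%N natrX expf_neq0 ?four_neq0. Qed.

Lemma sum_torsion4 (f : 'Z_n -> algC) :
  \sum_(k | k *+ 4 == 0) f k = f 0 + f t + f (t *+ 2) + f (t *+ 3).
Proof.
transitivity (\sum_(k <- [:: 0; t; t *+ 2; t *+ 3]) f k).
  rewrite [RHS]big_uniq /=.
    apply: eq_bigl => k; apply/eqP/idP; first exact: torsion4.
    rewrite !inE => /or4P[] /eqP ->; rewrite ?mul0rn ?t4 //.
      by rewrite -mulrnA mulnC mulrnA t4 mul0rn.
    by rewrite -mulrnA mulnC mulrnA t4 mul0rn.
  have e12 : (t == t *+ 2) = false.
    by rewrite mulr2n -subr_eq0 opprD addrA subrr sub0r oppr_eq0 (negPf t_neq0).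
  have e13 : (t == t *+ 3) = false.
    by rewrite t3E -addr_eq0 -mulr2n (negPf t2_neq0).
  have e23 : (t *+ 2 == t *+ 3) = false.
    by rewrite t3E -addr_eq0 -mulrSr (negPf t3_neq0).
  rewrite !inE ![0 == _]eq_sym (negPf t_neq0) (negPf t2_neq0) (negPf t3_neq0) /=.
  by rewrite e12 e13 e23.
by rewrite !big_cons big_nil addr0 !addrA.
Qed.

Lemma sum_torsion2 (f : 'Z_n -> algC) :
  \sum_(k | k *+ 2 == 0) f k = f 0 + f (t *+ 2).
Proof.
rewrite (bigID (fun k => k *+ 4 == 0)) /= [X in _ + X]big1 ?addr0; last first.
  by move=> k /andP[/eqP e]; rewrite -[4%N]/(2 * 2)%N mulrnA e mul0rn eqxx.
under eq_bigl => k do rewrite andbC.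
rewrite big_mkcondr sum_torsion4 mul0rn eqxx (negPf t2_neq0).
rewrite -!mulrnA [(2 * 2)%N]/= t4 eqxx -[(3 * 2)%N]/(4 + 2)%N mulrnDr t4 add0r.
by rewrite (negPf t2_neq0) !addr0.
Qed.

Lemma chi_t2_sq x : x != 0 -> X (t *+ 2) (x ^+ 2) = 1.
Proof. by move=> x0; rewrite chiX -mulrnA t4 triv_chi. Qed.

Lemma chi_t2N1 : X (t *+ 2) (-1) = 1.
Proof. by rewrite mulr2n chiD chiN1. Qed.

(** The identity 4x(1 - x) = 1 - (2x - 1)^2 turns the left side into the sum of [X k (1 - y ^+ 2)].
    Counting square roots splits the part y != 0 into J(0, k) = -1, which cancels the term y = 0,
    and J(2t, k). *)
Lemma jac_dup k : k != 0 -> X k 4%:R * J k k = J k (t *+ 2).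
Proof.
move=> k0; transitivity (\sum_y X k (1 - y ^+ 2)).
  rewrite /jac mulr_sumr [RHS](reindex_inj (mulIf two_neq0)) /=.
  rewrite (reindex_inj (addrI (2%:R^-1 : F))) /=.
  apply: eq_bigr => x _; rewrite -!chiM; congr (X _ _); field; exact: two_neq0.
rewrite (bigD1 (0 : F)) //= expr0n subr0 chi1.
rewrite (sum_powers 1 (fun s => X k (1 - s))).
under eq_bigr => u _ do rewrite sum_torsion2 mulrDl.
rewrite big_split /= -/(jac 0 k) -/(jac (t *+ 2) k) jac0 // addrA subrr add0r.
exact: jacC.
Qed.

Lemma hasse_davenport2 k :
  G k * G (k + t *+ 2) = X (- k) 4%:R * G (k *+ 2) * G (t *+ 2).
Proof.
have four := four_neq0.
have [k2|k2] := eqVneq (k *+ 2) 0.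
  (* Applied to the indicator of k, [sum_torsion2] shows that k is 0 or [t *+ 2]; both cases are
     checked directly. *)
  have : \sum_(l | l *+ 2 == 0) (l == k)%:R = 1 :> algC.
    rewrite (bigD1 k) ?k2 //= eqxx big1 ?addr0 // => l /andP[_].
    by move=> /negPf ->.
  rewrite k2 gauss0 sum_torsion2.
  have [<- _|_] := eqVneq 0 k.
    by rewrite add0r oppr0 triv_chi // gauss0; ring.
  have [<- _|_] := eqVneq (t *+ 2) k; last first.
    by move/eqP; rewrite addr0 eq_sym oner_eq0.
  rewrite -mulrnDr t4 gauss0 t2N.
  have -> : 4%:R = 2%:R ^+ 2 :> F by ring.
  by rewrite chi_t2_sq //; ring.
have k0 : k != 0 by apply: contraNneq k2 => ->; rewrite mul0rn.
have kt0 : k + t *+ 2 != 0.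
  rewrite addr_eq0 t2N; apply: contraNneq k2 => ->.
  by rewrite -mulrnA t4.
have := jac_dup k0; rewrite !jacE // -?mulr2n // => e.
apply: (mulfI (chi_neq0 k four)); rewrite !mulrA chiNK // mul1r.
move/(congr1 (fun z => z * G (k + t *+ 2) * G (k *+ 2) / G k)): e.
have ? := gauss_neq0 k; have ? := gauss_neq0 (k *+ 2).
have ? := gauss_neq0 (k + t *+ 2) => e.
transitivity (X k 4%:R * (G k * G k / G (k *+ 2)) * G (k + t *+ 2) * G (k *+ 2) / G k).
  by field; apply/andP.
by rewrite e; field; apply/andP.
Qed.

Lemma gauss_t2 : G (t *+ 2) * G (t *+ 2) = q.
Proof. by rewrite -{2}t2N gaussN // chi_t2N1 mul1r. Qed.

Lemma gauss_t13 : G t * G (t *+ 3) = X t (-1) * q.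
Proof. by rewrite t3E gaussN // t_neq0. Qed.

(** The duplication formula at k = t, compared with the value of G(t) G(3t), gives the value at 1/4.
    Since 1/4 is 4 times a fourth power, it is also the value at 4. *)
Lemma chi_t4 : X t 4%:R = X t (-1).
Proof.
have := hasse_davenport2 t; rewrite -mulrS gauss_t13 -mulrA gauss_t2.
move/(mulIf q_neq0) => ->; rewrite -chiV.
have -> : (4%:R : F)^-1 = 4%:R * (2%:R^-1) ^+ 4.
  by field; rewrite two_neq0 four_neq0.
by rewrite chiM chiX t4 triv_chi ?invr_neq0 // mulr1.
Qed.

(** The duplication formula at k pairs the factors 0 and 2t, at k + t it pairs t and 3t, and at 2k
    it joins the two results. *)
Lemma hasse_davenport4 k :
  G k * G (k + t) * G (k + t *+ 2) * G (k + t *+ 3) * X k 256%:R =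
  G (k *+ 4) * (G t * G (t *+ 2) * G (t *+ 3)).
Proof.
have four := four_neq0.
have e1 := hasse_davenport2 k.
have e2 := hasse_davenport2 (k + t).
have e3 := hasse_davenport2 (k *+ 2).
have {e2} e2 : G (k + t) * G (k + t *+ 3) =
    X (- k) 4%:R * X t (-1) * G (k *+ 2 + t *+ 2) * G (t *+ 2).
  move: e2; rewrite -addrA -mulrS mulrnDl opprD chiD => ->.
  congr (_ * _ * _ * _).
  by apply: (mulfI (chi_neq0 t four)); rewrite chiNK // chi_t4 chiN1.
have -> : 256%:R = 4%:R ^+ 4 :> F by ring.
rewrite chiX.
transitivity ((G k * G (k + t *+ 2)) * (G (k + t) * G (k + t *+ 3)) * X (k *+ 4) 4%:R).
  ring.
rewrite e1 e2.
transitivity ((G (k *+ 2) * G (k *+ 2 + t *+ 2)) * (G (t *+ 2) * G (t *+ 2))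
   * X t (-1) * (X (- k) 4%:R * X (- k) 4%:R * X (k *+ 4) 4%:R)); first by ring.
rewrite e3 gauss_t2 -!chiD -mulrnA.
transitivity (G (k *+ 4) * G (t *+ 2) * (G t * G (t *+ 3))
   * (X (- (k *+ 2)) 4%:R * X (- k - k + k *+ 4) 4%:R)).
  by rewrite gauss_t13; ring.
rewrite -chiD; have -> : - (k *+ 2) + (- k - k + k *+ 4) = 0 by ring.
by rewrite triv_chi //; ring.
Qed.

(** * The torus count as a character sum *)

Variable lam : F.
Hypothesis lam_neq0 : lam != 0.

Definition sum_chi4 x := \sum_(k | k *+ 4 == 0) X k x.

Lemma sum_chi4_0 : sum_chi4 0 = 0.
Proof. by rewrite /sum_chi4 big1. Qed.

Lemma sum_fourth_powers (f : F -> algC) :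
  \sum_(y | y != 0) f (y ^+ 4) = \sum_u sum_chi4 u * f u.
Proof. exact: sum_powers. Qed.

Definition torus_count : algC := \sum_(y | y != 0) \sum_(z | z != 0)
  \sum_(w | w != 0) (1 + y ^+ 4 + z ^+ 4 + w ^+ 4 == 4%:R * lam * (y * z * w))%:R.

(* The substitution w = P / (y z) makes the equation depend on y and z through
   their fourth powers only. *)
Lemma torus_count_powers : torus_count =
  \sum_u sum_chi4 u * \sum_v sum_chi4 v *
    \sum_(P | P != 0) (1 + u + v + P ^+ 4 / (u * v) == 4%:R * lam * P)%:R.
Proof.
rewrite -sum_fourth_powers; apply: eq_bigr => y y0.
rewrite -(sum_fourth_powers (fun v => \sum_(P | P != 0)
  (1 + y ^+ 4 + v + P ^+ 4 / (y ^+ 4 * v) == 4%:R * lam * P)%:R)).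
apply: eq_bigr => z z0; have yz : y * z != 0 by rewrite mulf_neq0.
rewrite (reindex_onto (fun P => P / (y * z)) (fun w => w * (y * z))) /=; last first.
  by move=> w _; rewrite mulfK.
apply: eq_big => [P|P _].
  by rewrite mulfVK // eqxx andbT mulf_eq0 invr_eq0 (negPf yz) orbF.
congr ((_ == _)%:R); last by field; apply/andP.
by congr (_ + _); rewrite -exprMn expr_div_n.
Qed.

(** For fixed u and v the solutions P and w determine each other, by w = P^4 / (uv) and P = (1 + u +
    v + w) / (4 lam). Eliminating P leaves the equation in w. *)
Lemma sum_eliminate_product u v : u != 0 -> v != 0 ->
  \sum_(P | P != 0) (1 + u + v + P ^+ 4 / (u * v) == 4%:R * lam * P)%:R =
  \sum_(w | w != 0) ((1 + u + v + w) ^+ 4 == lam ^+ 4 * (256%:R * (u * v * w)))%:R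
  :> algC.
Proof.
move=> u0 v0; have uv : u * v != 0 by rewrite mulf_neq0.
have l0 : 4%:R * lam != 0 by rewrite mulf_neq0 // four_neq0.
have key P w : (P != 0) && ((w == P ^+ 4 / (u * v)) && (1 + u + v + w == 4%:R * lam * P))
   = (w != 0) && ((P == (1 + u + v + w) / (4%:R * lam)) &&
     ((1 + u + v + w) ^+ 4 == lam ^+ 4 * (256%:R * (u * v * w)))).
  apply/idP/idP.
    case/and3P=> P0 /eqP ew /eqP es.
    rewrite es [4%:R * lam * P]mulrC mulfK // eqxx /= {1}ew mulf_neq0 ?expf_neq0
      ?invr_neq0 //=.
    by apply/eqP; rewrite ew; field; apply/andP.
  case/and3P=> w0 /eqP eP /eqP es.
  have s0 : 1 + u + v + w != 0.
    apply: contra_eq_neq es => ->; rewrite expr0n /= eq_sym.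
    by rewrite !mulf_neq0 ?expf_neq0 ?c256_neq0.
  have P0 : P != 0 by rewrite eP mulf_neq0 ?invr_neq0.
  rewrite P0 /= eP expr_div_n es [4%:R * lam * _]mulrC mulfVK // eqxx andbT.
  by apply/eqP; field; rewrite u0 v0 lam_neq0 four_neq0.
transitivity (\sum_P \sum_w ((P != 0) && ((w == P ^+ 4 / (u * v))
    && (1 + u + v + w == 4%:R * lam * P)))%:R : algC).
  rewrite big_mkcond; apply: eq_bigr => P _.
  rewrite (bigD1 (P ^+ 4 / (u * v))) //= eqxx /= big1 ?addr0; last first.
    by move=> w /negPf ->; rewrite andbF.
  by case: eqP.
rewrite exchange_big [RHS]big_mkcond /=; apply: eq_bigr => w _.
under eq_bigr => P _ do rewrite key.
rewrite (bigD1 ((1 + u + v + w) / (4%:R * lam))) //= eqxx /= big1 ?addr0.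
  by case: eqP.
by move=> P /negPf ->; rewrite andbF.
Qed.

Lemma torus_count_jac4 : N * torus_count =
  \sum_k X k (lam ^+ 4) * (\sum_(a | a *+ 4 == 0) \sum_(b | b *+ 4 == 0)
     X k 256%:R * jac4 (a + k) (b + k) k (- (k *+ 4))).
Proof.
have c0 := c256_neq0.
rewrite torus_count_powers mulr_sumr.
transitivity (\sum_u \sum_v \sum_w \sum_k sum_chi4 u * sum_chi4 v *
   (X k (lam ^+ 4) * X k 256%:R * X k u * X k v * X k w
     * X (- (k *+ 4)) (1 + u + v + w))).
  apply: eq_bigr => u _; have [->|u0] := eqVneq u 0.
    rewrite sum_chi4_0 mul0r mulr0 big1 // => v _; rewrite big1 // => w _.
    by rewrite big1 // => k _; rewrite !chi0; ring.
  move: (sum_chi4 u) => Eu; rewrite !mulr_sumr; apply: eq_bigr => v _.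
  have [->|v0] := eqVneq v 0.
    rewrite sum_chi4_0 mul0r !mulr0 big1 // => w _.
    by rewrite big1 // => k _; rewrite !chi0; ring.
  move: (sum_chi4 v) => Ev.
  rewrite sum_eliminate_product // big_mkcond !mulr_sumr; apply: eq_bigr => w _.
  rewrite -[RHS]mulr_sumr; have [->|w0] := eqVneq w 0.
    rewrite [X in _ = _ * X]big1 ?eqxx ?mulr0 // => k _.
    by rewrite chi0; ring.
  have y0 : lam ^+ 4 * (256%:R * (u * v * w)) != 0.
    by rewrite !mulf_neq0 // expf_neq0.
  have := dual_orth ((1 + u + v + w) ^+ 4) y0.
  (* Replacing k by -k puts [X k] on the side of lam^4 and [X (- (k *+ 4))] on 1 + u + v + w. *)
  rewrite (reindex_inj (@oppr_inj _)) /=.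
  under eq_bigr => k _ do rewrite opprK chiX mulNrn mulrC.
  move=> e; transitivity (Eu * Ev * (if (1 + u + v + w) ^+ 4 ==
     lam ^+ 4 * (256%:R * (u * v * w)) then N else 0)).
    by case: eqP => _ /=; ring.
  by rewrite -e; congr (_ * _); apply: eq_bigr => k _; rewrite !chiM; ring.
under eq_bigr => u _ do under eq_bigr => v _ do rewrite exchange_big /=.
under eq_bigr => u _ do rewrite exchange_big /=.
rewrite exchange_big /=; apply: eq_bigr => k _.
transitivity (\sum_(a | a *+ 4 == 0) \sum_u \sum_(b | b *+ 4 == 0) \sum_v \sum_w
   X k (lam ^+ 4) * (X k 256%:R * (X (a + k) u * X (b + k) v * X k w
     * X (- (k *+ 4)) (1 + u + v + w)))).
  rewrite [RHS]exchange_big /=; apply: eq_bigr => u _.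
  under [RHS]eq_bigr => a _ do rewrite exchange_big /=.
  rewrite [RHS]exchange_big /=; apply: eq_bigr => v _.
  under [RHS]eq_bigr => a _ do rewrite exchange_big /=.
  rewrite [RHS]exchange_big /=; apply: eq_bigr => w _.
  rewrite /sum_chi4 -[LHS]mulrA mulr_suml; apply: eq_bigr => a _.
  rewrite mulr_suml mulr_sumr; apply: eq_bigr => b _.
  by rewrite !chiD; ring.
rewrite mulr_sumr; apply: eq_bigr => a _; rewrite exchange_big /= mulr_sumr.
apply: eq_bigr => b _; rewrite /jac4 !mulr_sumr; apply: eq_bigr => u _.
rewrite !mulr_sumr; apply: eq_bigr => v _.
by rewrite !mulr_sumr.
Qed.

Local Notation a1 := (G t).
Local Notation a2 := (G (t *+ 2)).
Local Notation a3 := (G (t *+ 3)).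
Local Notation e := (X t (-1)).

(** The addition table of Z/4 on the multiples of t, packed as one rewrite rule; each entry holds up
    to a multiple of [t *+ 4]. *)
Lemma t_arith : ((t + t = t *+ 2) * (t + t *+ 2 = t *+ 3) * (t + t *+ 3 = 0)
  * (t *+ 2 + t = t *+ 3) * (t *+ 2 + t *+ 2 = 0) * (t *+ 2 + t *+ 3 = t)
  * (t *+ 3 + t = 0) * (t *+ 3 + t *+ 2 = t) * (t *+ 3 + t *+ 3 = t *+ 2)
  * (- t = t *+ 3) * (- (t *+ 2) = t *+ 2) * (- (t *+ 3) = t)).
Proof.
have mod4 x y : x - y = t *+ 4 -> x = y by rewrite t4 => /subr0_eq.
do !split; first [by ring | by apply: mod4; ring | by symmetry; apply: mod4; ring].
Qed.

Lemma chi_eval : (X 0 (-1) = 1) * (X (t *+ 2) (-1) = 1) * (X (t *+ 3) (-1) = e).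
Proof.
by rewrite chi_t2N1 t3E chiN1N triv_chi // oppr_eq0 oner_eq0.
Qed.

Lemma torsion_eq0 k : k *+ 4 = 0 -> forall x, x != 0 -> X k (x ^+ 4) = 1.
Proof. by move=> k4 x x0; rewrite chiX k4 triv_chi. Qed.

(** * Fourier coefficients as quotients of Gauss sums *)

(** The first branch is the degenerate value from [jac4E0]. There the generic quotient would be -Q,
    since G(0) = -1 and the character is 1 at 256 = 4^4; the true coefficient has an extra 1/q. *)
Definition twist (Q : 'Z_n -> algC) k :=
  if k *+ 4 == 0 then - Q k / q else X k 256%:R * Q k / G (k *+ 4).

Lemma jac4_twist a b k : a *+ 4 = 0 -> b *+ 4 = 0 ->
  X k 256%:R * jac4 (a + k) (b + k) k (- (k *+ 4)) =
  twist (fun k => G k * G (k + a) * G (k + b) * G (k - (a + b))) k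
  + (if [&& a == 0, b == 0 & k == 0] then N ^+ 4 / q else 0).
Proof.
move=> ha hb; rewrite /twist.
have e1 : - (a + k + (b + k) + k + - (k *+ 4)) = k - (a + b) by ring.
have [k4|k4] := eqVneq (k *+ 4) 0; last first.
  have -> : (k == 0) = false.
    by apply: contraNF k4 => /eqP ->; rewrite mul0rn.
  rewrite !andbF addr0 jac4E ?oppr_eq0 // e1 opprK [a + k]addrC [b + k]addrC.
  by ring.
have -> : 256%:R = 4%:R ^+ 4 :> F by ring.
rewrite torsion_eq0 ?four_neq0 // mul1r k4 oppr0 jac4E0.
have -> : - (a + k + (b + k) + k) = k - (a + b).
  by rewrite -[k - _]subr0 -k4; ring.
rewrite [a + k]addrC [b + k]addrC.
have [->|k0] := eqVneq k 0; first by rewrite !add0r andbT; case: ifP; rewrite ?andbT =>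
  ->; ring.
by rewrite !andbF; ring.
Qed.

Definition dsum (R : 'Z_n -> algC) := \sum_k X k (lam ^+ 4) * R k.

Lemma dsum_ext R R' : R =1 R' -> dsum R = dsum R'.
Proof. by move=> h; apply: eq_bigr => k _; rewrite h. Qed.

Lemma dsum_twist_ext Q Q' : Q =1 Q' -> dsum (twist Q) = dsum (twist Q').
Proof. by move=> h; apply: dsum_ext => k; rewrite /twist h. Qed.

(** A character of order dividing 4 is 1 at lam^4 and at 256 = 4^4, and 4(k + c) = 4k; a shift by c
    thus merely permutes the summands. *)
Lemma dsum_twist_shift Q c : c *+ 4 = 0 ->
  dsum (twist (fun k => Q (k + c))) = dsum (twist Q).
Proof.
move=> hc; rewrite /dsum [RHS](reindex_inj (addIr c)) /=; apply: eq_bigr => k _.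
rewrite chiD (torsion_eq0 hc) // mulr1 /twist mulrnDl hc addr0 chiD.
have -> : 256%:R = 4%:R ^+ 4 :> F by ring.
by rewrite (torsion_eq0 hc) ?four_neq0 // mulr1.
Qed.

(* The characters of order dividing 4 take the value 1 at lam ^+ 4. *)
Lemma dsum_twist_cmp Q R :
  (forall k, k *+ 4 != 0 -> X k 256%:R * Q k / G (k *+ 4) = R k) ->
  dsum (twist Q) = dsum R - \sum_(k | k *+ 4 == 0) (Q k / q + R k).
Proof.
move=> h; rewrite /dsum [X in _ = _ - X]big_mkcond -sumrB.
apply: eq_bigr => k _; rewrite /twist; case: eqP => [k4|/eqP k4].
  by rewrite torsion_eq0 //; ring.
by rewrite h // subr0.
Qed.

Definition gauss_prod0000 k := G k ^+ 4.
Definition gauss_prod0022 k := G k ^+ 2 * G (k + t *+ 2) ^+ 2.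
Definition gauss_prod0013 k := G k ^+ 2 * G (k + t) * G (k + t *+ 3).

Lemma torus_count_dsum : N * torus_count = N ^+ 4 / q + dsum (twist gauss_prod0000)
  + 3%:R * dsum (twist gauss_prod0022) + 12%:R * dsum (twist gauss_prod0013).
Proof.
pose Q a b k := G k * G (k + a) * G (k + b) * G (k - (a + b)).
transitivity (N ^+ 4 / q + \sum_(a | a *+ 4 == 0) \sum_(b | b *+ 4 == 0)
   dsum (twist (Q a b))).
  rewrite torus_count_jac4.
  under eq_bigr => k _ do under eq_bigr => a /eqP ha do
    under eq_bigr => b /eqP hb do rewrite jac4_twist //.
  under eq_bigr => k _ do under eq_bigr => a ha do rewrite big_split /=.
  under eq_bigr => k _ do rewrite big_split mulrDr /=.
  rewrite big_split /= addrC; congr (_ + _).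
    rewrite (bigD1 (0 : 'Z_n)) //= triv_chi ?expf_neq0 // mul1r.
    rewrite (bigD1 (0 : 'Z_n)) ?mul0rn //= (bigD1 (0 : 'Z_n)) ?mul0rn //= eqxx.
    rewrite !big1 ?addr0 //.
    - by move=> k /negPf k0; rewrite big1 ?mulr0 // => a _; rewrite big1 // => b _;
      rewrite k0 !andbF.
    - by move=> a /andP[_ /negPf a0]; rewrite big1 // => b _; rewrite a0.
    - by move=> b /andP[_ /negPf b0]; rewrite b0.
  under eq_bigr => k _ do rewrite mulr_sumr.
  rewrite exchange_big; apply: eq_bigr => a _ /=.
  under eq_bigr => k _ do rewrite mulr_sumr.
  by rewrite exchange_big.
rewrite -!addrA; congr (_ + _).
have S a b Q' : Q a b =1 Q' -> dsum (twist (Q a b)) = dsum (twist Q').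
  exact: dsum_twist_ext.
have S1 : dsum (twist (fun k => gauss_prod0013 (k + t))) = dsum (twist gauss_prod0013).
  exact: dsum_twist_shift.
have S3 : dsum (twist (fun k => gauss_prod0013 (k + t *+ 3))) = dsum (twist gauss_prod0013).
  by apply: dsum_twist_shift; rewrite -mulrnA mulnC mulrnA t4 mul0rn.
rewrite !sum_torsion4.
(* The pattern of (a, b) is {0, a, b, -a-b} modulo 4. Six of the twelve pairs of type 0013 match
   only after a shift: by t for (t,t), (t,2t), (2t,t), and by 3t for (2t,3t), (3t,2t), (3t,3t). *)
rewrite (S 0 0 gauss_prod0000) ?(S 0 t gauss_prod0013) ?(S 0 (t *+ 2) gauss_prod0022) ?(S
  0 (t *+ 3) gauss_prod0013)
  ?(S t 0 gauss_prod0013) ?(S t t (fun k => gauss_prod0013 (k + t))) ?(S t (t *+ 2) (fun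
    k => gauss_prod0013 (k + t)))
  ?(S t (t *+ 3) gauss_prod0013) ?(S (t *+ 2) 0 gauss_prod0022) ?(S (t *+ 2) t (fun k =>
    gauss_prod0013 (k + t)))
  ?(S (t *+ 2) (t *+ 2) gauss_prod0022) ?(S (t *+ 2) (t *+ 3) (fun k => gauss_prod0013 (k
    + t *+ 3)))
  ?(S (t *+ 3) 0 gauss_prod0013) ?(S (t *+ 3) t gauss_prod0013)
  ?(S (t *+ 3) (t *+ 2) (fun k => gauss_prod0013 (k + t *+ 3)))
  ?(S (t *+ 3) (t *+ 3) (fun k => gauss_prod0013 (k + t *+ 3))) ?S1 ?S3;
  try by move=> k; rewrite /Q /gauss_prod0000 /gauss_prod0022 /gauss_prod0013 -?addrA
    ?t_arith ?add0r ?addr0 ?t_arith ?oppr0 ?addr0; ring.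
by ring.
Qed.

(** * Comparison with hypergeometric coefficients *)

(** The three coefficients are written with fixed nonzero denominators, so that they are products of
    Jacobi sums at every k, up to constants and signs. They agree with [twist] only where [k *+ 4]
    is nonzero. *)
Definition coef_3F2 k := X k (-1) * G (t - k) * G (t *+ 2 - k) * G (t *+ 3 - k)
  * G k ^+ 3 / (a1 * a2 * a3).
Definition coef_2F1 k := e * G (t *+ 3 - k) * G k * G (t - k) * G (t *+ 2 + k) / a2.
Definition coef_quadratic k := q * e * X k (-1) * G k * G (t *+ 2 - k) / a2.

Lemma chiN1_sq k : X k (-1) ^+ 2 = 1.
Proof. by rewrite expr2 chiN1. Qed.

Lemma gauss_t3E : a3 = e * q / a1.
Proof. by rewrite -gauss_t13 mulrC mulKf ?gauss_neq0. Qed.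

Lemma gauss_refl k c : k + c != 0 ->
  G (- c - k) = X k (-1) * X c (-1) * q / G (k + c).
Proof.
move=> kc; rewrite -chiD -gaussN // mulrC mulKf ?gauss_neq0 //.
by congr G; ring.
Qed.

Lemma gauss_t123 : a1 * a2 * a3 = e * q * a2.
Proof. by rewrite mulrAC gauss_t13. Qed.

Lemma hasse_davenport4_div k : X k 256%:R / G (k *+ 4) =
  e * q * a2 / (G k * G (k + t) * G (k + t *+ 2) * G (k + t *+ 3)).
Proof.
have := hasse_davenport4 k; rewrite gauss_t123.
have ? := gauss_neq0 k; have ? := gauss_neq0 (k + t).
have ? := gauss_neq0 (k + t *+ 2); have ? := gauss_neq0 (k + t *+ 3).
have ? := gauss_neq0 (k *+ 4) => h.
apply/eqP; rewrite eqr_div ?mulf_neq0 //; apply/eqP.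
by rewrite mulrC h; ring.
Qed.

Section Compare.

Variable k : 'Z_n.
Hypothesis k4 : k *+ 4 != 0.

Lemma shift_neq0 c : c *+ 4 = 0 -> k + c != 0.
Proof.
move=> hc; apply: contraNneq k4 => h; move: (congr1 (fun z => z *+ 4) h).
by rewrite mulrnDl hc addr0 mul0rn => ->.
Qed.

Let t4' : (t *+ 2) *+ 4 = 0.
Proof. by rewrite -mulrnA mulnC mulrnA t4 mul0rn. Qed.

Let t4'' : (t *+ 3) *+ 4 = 0.
Proof. by rewrite -mulrnA mulnC mulrnA t4 mul0rn. Qed.

Let refl1 : G (t *+ 3 - k) = X k (-1) * e * q / G (k + t).
Proof. by rewrite -gauss_refl ?shift_neq0 // t_arith. Qed.

Let refl2 : G (t *+ 2 - k) = X k (-1) * q / G (k + t *+ 2).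
Proof.
by have := gauss_refl (shift_neq0 t4'); rewrite t_arith chi_eval mulr1.
Qed.

Let refl3 : G (t - k) = X k (-1) * e * q / G (k + t *+ 3).
Proof. by have := gauss_refl (shift_neq0 t4''); rewrite t_arith chi_eval. Qed.

Let g0 := gauss_neq0 k.
Let g1 := gauss_neq0 (k + t).
Let g2 := gauss_neq0 (k + t *+ 2).
Let g3 := gauss_neq0 (k + t *+ 3).
Let h1 := gauss_neq0 t.
Let h2 := gauss_neq0 (t *+ 2).
Let h3 := gauss_neq0 (t *+ 3).

(** Hasse-Davenport puts G(k), G(k + t), G(k + 2t), G(k + 3t) in the denominator. Factors of the
    pattern cancel some of them, and reflection moves the remaining ones to the numerator; the other
    two patterns work alike. *)
Lemma twist_gauss_prod0000 : X k 256%:R * gauss_prod0000 k / G (k *+ 4) = coef_3F2 k.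
Proof.
rewrite mulrAC hasse_davenport4_div /coef_3F2 /gauss_prod0000 refl1 refl2 refl3.
rewrite gauss_t123.
have e0 : e != 0 by rewrite chi_neq0 // oppr_eq0 oner_eq0.
have q0 := q_neq0.
(* This form isolates the squares of signs and [a2 * a2], which must become 1 and q before [field]
   can finish. *)
transitivity ((X k (-1) ^+ 2) ^+ 2 * e * q ^+ 2 / (a2 * a2) * a2
   * G k ^+ 3 / (G (k + t) * G (k + t *+ 2) * G (k + t *+ 3))); last first.
  by field; do ?[apply/andP; split].
by rewrite gauss_t2 !chiN1_sq; field; do ?[apply/andP; split].
Qed.

Lemma twist_gauss_prod0022 : X k 256%:R * gauss_prod0022 k / G (k *+ 4) = coef_2F1 k.
Proof.
rewrite mulrAC hasse_davenport4_div /coef_2F1 /gauss_prod0022 refl1 refl3 [t *+ 2 + k]addrC.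
transitivity (X k (-1) ^+ 2 * e ^+ 2 * e * q ^+ 2 * a2 / (a2 * a2) * G k
  * G (k + t *+ 2) / (G (k + t) * G (k + t *+ 3))); last first.
  by field; do ?[apply/andP; split].
have q0 := q_neq0.
by rewrite gauss_t2 !chiN1_sq; field; do ?[apply/andP; split].
Qed.

Lemma twist_gauss_prod0013 : X k 256%:R * gauss_prod0013 k / G (k *+ 4) = coef_quadratic k.
Proof.
rewrite mulrAC hasse_davenport4_div /coef_quadratic /gauss_prod0013 refl2.
transitivity (X k (-1) ^+ 2 * e * q ^+ 2 * a2 / (a2 * a2) * G k
  / G (k + t *+ 2)); last first.
  by field; do ?[apply/andP; split].
have q0 := q_neq0.
by rewrite gauss_t2 !chiN1_sq; field; do ?[apply/andP; split].
Qed.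

End Compare.

(** The coefficient is a single Jacobi sum J(k, 2t - k) up to sign and constant. Summing over k
    first forces -lam^4 y = 1 - y, whose only solution is y = 1 / (1 - lam^4), and which has none
    when lam^4 = 1. *)
Lemma dsum_coef_quadratic : dsum coef_quadratic = N * (q * e * X (t *+ 2) (1 - lam ^+ 4)).
Proof.
have coefE k : coef_quadratic k = q * e * (X k (-1) * J k (t *+ 2 - k)).
  have d : k + (t *+ 2 - k) = t *+ 2 by ring.
  by rewrite jacE d // /coef_quadratic; ring.
transitivity (q * e * \sum_y X (t *+ 2) (1 - y)
   * \sum_k X k (- lam ^+ 4 * y) * X (- k) (1 - y)).
  rewrite /dsum; under eq_bigr => k _ do rewrite coefE /jac !mulr_sumr.
  rewrite exchange_big mulr_sumr /=; apply: eq_bigr => y _; rewrite !mulr_sumr.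
  apply: eq_bigr => k _.
  have -> : - lam ^+ 4 * y = -1 * (lam ^+ 4 * y) by ring.
  by rewrite chiD (chiM k (-1)) (chiM k (lam ^+ 4)); ring.
rewrite [X in q * e * X](_ : _ = N * X (t *+ 2) (1 - lam ^+ 4)); last first.
  have [l1|l1] := eqVneq (lam ^+ 4) 1.
    rewrite l1 subrr chi0 mulr0 big1 // => y _.
    have [->|y1] := eqVneq y 1; first by rewrite subrr chi0 mul0r.
    rewrite dual_orth ?subr_eq0 1?eq_sym //; case: eqP; rewrite ?mulr0 //.
    move/(congr1 (fun z => z + y))/eqP.
    by rewrite subrK mulN1r addNr oner_eq0.
  have d0 : 1 - lam ^+ 4 != 0 by rewrite subr_eq0 eq_sym.
  rewrite (bigD1 (1 - lam ^+ 4)^-1) //= [X in _ + X]big1 ?addr0.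
    have y0 : 1 - (1 - lam ^+ 4)^-1 = - lam ^+ 4 * (1 - lam ^+ 4)^-1 by field.
    rewrite y0 dual_orth ?eqxx.
      rewrite chiM chi_opp chi_t2N1 mul1r chiV t2N [lam ^+ 4](exprM _ 2 2).
      by rewrite chi_t2_sq ?expf_neq0 // mul1r mulrC.
    by rewrite mulf_neq0 ?oppr_eq0 ?expf_neq0 ?invr_neq0.
  move=> y yn; have [->|y1] := eqVneq y 1; first by rewrite subrr chi0 mul0r.
  rewrite dual_orth ?subr_eq0 1?eq_sym //; case: eqP; rewrite ?mulr0 // => h.
  case/eqP: yn; apply: (mulIf d0); rewrite mulVf //.
  by rewrite mulrBr mulr1 [y * _]mulrC -mulNr -h addrC subrK.
by ring.
Qed.

(** This is J(t, t) + J(3t, 3t), the one quantity here that is not elementary. It enters the torus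
    count as -12u and four times the curve count as +12u. *)
Let u := (a1 ^+ 2 + a3 ^+ 2) / a2.

Lemma e_sign : e = 1 \/ e = -1.
Proof.
by have /eqP := chiN1_sq t; rewrite sqrf_eq1 => /orP[] /eqP; [left | right].
Qed.

Lemma N_gauss : N = a2 * a2 - 1.
Proof. by rewrite gauss_t2 qE addrK. Qed.

(* Every quantity is a rational function of a1, a2 and the sign e. *)
Ltac gauss_field :=
  rewrite ?gauss_t3E ?N_gauss -gauss_t2;
  have ? := gauss_neq0 t; have ? := gauss_neq0 (t *+ 2);
  case: e_sign => ->; field; by do ?[apply/andP; split].

(** The four exceptional characters are evaluated from G(0) = -1, G(2t)^2 = q and G(t) G(3t) = e q;
    the two lemmas that follow proceed in the same way. *)
Lemma dsum_gauss_prod0000 : dsum (twist gauss_prod0000) = dsum coef_3F2 + N / q.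
Proof.
rewrite (dsum_twist_cmp twist_gauss_prod0000); congr (_ + _).
rewrite sum_torsion4 /gauss_prod0000 /coef_3F2 ?subr0 !t_arith ?addr0 ?add0r ?subrr
  !gauss0 !chi_eval.
gauss_field.
Qed.

Lemma dsum_gauss_prod0022 : dsum (twist gauss_prod0022) = dsum coef_2F1 + N * 2%:R.
Proof.
rewrite (dsum_twist_cmp twist_gauss_prod0022); congr (_ + _).
rewrite sum_torsion4 /gauss_prod0022 /coef_2F1 ?subr0 ?addr0 ?add0r !t_arith ?subrr !gauss0.
gauss_field.
Qed.

Lemma dsum_gauss_prod0013 : dsum (twist gauss_prod0013) = dsum coef_quadratic + N * (e - u).
Proof.
rewrite (dsum_twist_cmp twist_gauss_prod0013) /u; congr (_ + _).
rewrite sum_torsion4 /gauss_prod0013 /coef_quadratic ?subr0 ?addr0 ?add0r !t_arith ?subrr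
  !gauss0 !chi_eval.
gauss_field.
Qed.

(** * The strata with vanishing coordinates, and the total *)

(** When a coordinate vanishes the product term drops out, leaving a Fermat quartic. This counts its
    points with all three remaining coordinates nonzero, and [point_count] is the analogue for
    two. *)
Definition curve_count : algC :=
  \sum_(y : F | y != 0) \sum_(z : F | z != 0) (1 + y ^+ 4 + z ^+ 4 == 0)%:R.

Definition point_count : algC := \sum_(y : F | y != 0) (1 + y ^+ 4 == 0)%:R.

Lemma point_countE : point_count = 2%:R + 2%:R * e.
Proof.
rewrite /point_count; under eq_bigr => y _ do rewrite addrC addr_eq0.
rewrite (card_roots 3) ?oppr_eq0 ?oner_eq0 // sum_torsion4 !chi_eval; ring.
Qed.

Lemma curve_countE : curve_count = q - 5%:R - 6%:R * e + 3%:R * u.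
Proof.
transitivity (\sum_(a | a *+ 4 == 0) \sum_(b | b *+ 4 == 0)
   X (a + b) (-1) * J a b).
  transitivity (\sum_u \sum_v sum_chi4 u * sum_chi4 v * (1 + u + v == 0)%:R).
    rewrite /curve_count.
    rewrite (sum_fourth_powers (fun u => \sum_(z | z != 0) (1 + u + z ^+ 4 == 0)%:R)).
    apply: eq_bigr => y _; rewrite (sum_fourth_powers (fun v => (1 + y + v == 0)%:R)).
    by rewrite mulr_sumr; apply: eq_bigr => z _; rewrite mulrA.
  (* With u = -x, the equation 1 + u + v = 0 gives v = -(1 - x), the shape of a Jacobi sum. *)
  transitivity (\sum_x sum_chi4 (- x) * sum_chi4 (- (1 - x))).
    rewrite (reindex_inj (@oppr_inj _)) /=; apply: eq_bigr => x _.
    rewrite (bigD1 (- (1 - x))) //= subrr eqxx mulr1 big1 ?addr0 // => v vn.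
    case: eqP; rewrite ?mulr0 // => h; case/eqP: vn.
    by apply/eqP; rewrite -addr_eq0 addrC h.
  under eq_bigr => x _ do rewrite mulr_suml.
  rewrite exchange_big; apply: eq_bigr => a _ /=.
  under eq_bigr => x _ do rewrite mulr_sumr.
  rewrite exchange_big; apply: eq_bigr => b _ /=; rewrite /jac mulr_sumr.
  by apply: eq_bigr => x _; rewrite chi_opp [X b _]chi_opp chiD; ring.
rewrite !sum_torsion4 ?addr0 ?add0r !t_arith !chi_eval.
have ? := t_neq0; have ? := t3_neq0.
rewrite jac00 [J t 0]jacC [J (t *+ 2) 0]jacC [J (t *+ 3) 0]jacC !jac0 //.
have j13 : J t (t *+ 3) = - e by rewrite t3E jacN.
have j22 : J (t *+ 2) (t *+ 2) = -1 by rewrite -{2}t2N jacN // chi_eval.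
rewrite [J (t *+ 3) t]jacC j13 j22 !jacE ?t_arith // /u.
gauss_field.
Qed.

(** The constant terms in e and u cancel. What remains is (N^3 + 1)/q + 4q - 2, which equals q^2 + q
    + 1 because N^3 + 1 = q(N^2 - N + 1). *)
Lemma total_count :
  N * (torus_count + 4%:R * curve_count + 6%:R * point_count) =
  q ^+ 3 - 1 + N * (12%:R * q * e * X (t *+ 2) (1 - lam ^+ 4))
  + dsum coef_3F2 + 3%:R * dsum coef_2F1.
Proof.
rewrite !mulrDr torus_count_dsum dsum_gauss_prod0000 dsum_gauss_prod0022
  dsum_gauss_prod0013 dsum_coef_quadratic point_countE curve_countE.
have -> : N = q - 1 by rewrite qE addrK.
by field; exact: q_neq0.
Qed.

(** * Return to Jacobi sums and the special value at 1 *)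

(** Inverting the summation character moves the argument from lam^4 to its inverse and gives the
    Jacobi sums of Greene's coefficients. *)
Lemma dsum_coef_3F2_jac : dsum coef_3F2 = \sum_k X k (-1) * J (t + k) (- k)
  * J (t *+ 2 + k) (- k) * J (t *+ 3 + k) (- k) * X k (lam ^+ 4)^-1.
Proof.
rewrite [RHS](reindex_inj (@oppr_inj _)) /=; apply: eq_bigr => k _.
rewrite opprK chiN1N chiV opprK !jacE ?subrK ?t_neq0 ?t3_neq0 // /coef_3F2.
have ? := gauss_neq0 t; have ? := gauss_neq0 (t *+ 2).
have ? := gauss_neq0 (t *+ 3).
by field; do ?[apply/andP; split].
Qed.

Lemma coef_2F1_jac k : coef_2F1 k = e * J (t *+ 3) (t *+ 3) * (J (t *+ 3 - k) k * J (t -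
  k) (t *+ 2 + k)).
Proof.
have d : t - k + (t *+ 2 + k) = t *+ 3 by ring.
rewrite !jacE ?subrK ?d ?t_arith ?t3_neq0 // /coef_2F1.
have ? := gauss_neq0 (t *+ 2); have ? := gauss_neq0 (t *+ 3).
by field; do ?[apply/andP; split].
Qed.

Lemma dsum_coef_2F1_jac : dsum coef_2F1 = e * J (t *+ 3) (- t) *
  \sum_k J (t *+ 3 + k) (- k) * J (t + k) (- (t *+ 2 + k)) * X k (lam ^+ 4)^-1.
Proof.
rewrite mulr_sumr [RHS](reindex_inj (@oppr_inj _)) /=; apply: eq_bigr => k _.
by rewrite coef_2F1_jac opprK chiV opprK opprB addrC [k - _]addrC !t_arith; ring.
Qed.

(** A finite field analogue of Gauss's summation of 2F1 at 1. Summing over k first forces (1 - x)(1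
    - y) = xy, that is x = 1 - y, and leaves N J(t, t); its product with J(3t, 3t) is N q, since
    G(t) G(3t) = e q. *)
Lemma dsum_coef_2F1_at1 : lam ^+ 4 = 1 -> dsum coef_2F1 = N * (q * e).
Proof.
move=> l1; rewrite /dsum l1; under eq_bigr => k _ do rewrite chi1 mul1r coef_2F1_jac.
rewrite -mulr_sumr (_ : \sum_k _ = N * J t t).
  rewrite !jacE ?t_arith ?t3_neq0 //.
  gauss_field.
transitivity (\sum_y \sum_x \sum_k X (t *+ 3) x * X t y * X (t *+ 2) (1 - y)
    * (X k ((1 - x) * (1 - y)) * X (- k) (x * y))).
  under [RHS]eq_bigr => y _ do rewrite exchange_big /=.
  rewrite [RHS]exchange_big /=; apply: eq_bigr => k _.
  rewrite mulrC {1}/jac mulr_suml; apply: eq_bigr => y _.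
  rewrite /jac mulr_sumr; apply: eq_bigr => x _.
  by rewrite !chiD !chiM; ring.
rewrite /jac mulr_sumr; apply: eq_bigr => y _.
have [->|y0] := eqVneq y 0.
  by rewrite big1 ?chi0 ?mul0r ?mulr0 // => x _; rewrite big1 // => k _; rewrite ?chi0;
    ring.
have key x : x != 0 -> ((1 - x) * (1 - y) == x * y) = (x == 1 - y).
  move=> x0; rewrite -subr_eq0 -[RHS]subr_eq0 -oppr_eq0.
  by congr (_ == 0); ring.
under eq_bigr => x _ do rewrite -mulr_sumr.
have [->|y1] := eqVneq y 1.
  by rewrite big1 ?subrr ?chi0 ?mulr0 // => x _; rewrite mulr0 mul0r.
have y1' : 1 - y != 0 by rewrite subr_eq0 eq_sym.
rewrite (bigD1 (1 - y)) //= dual_orth ?mulf_neq0 // key // eqxx big1 ?addr0.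
  have -> : X t (1 - y) = X (t *+ 3) (1 - y) * X (t *+ 2) (1 - y).
    by rewrite -chiD t_arith.
  by ring.
move=> x xy; have [->|x0] := eqVneq x 0; first by rewrite chi0 !mul0r.
by rewrite dual_orth ?mulf_neq0 // key // (negPf xy) mulr0.
Qed.

(** In this form only Jacobi sums occur, so the conclusion no longer mentions [psi]. *)
Lemma count_formula
  (H := \sum_k X k (-1) * J (t + k) (- k) * J (t *+ 2 + k) (- k)
          * J (t *+ 3 + k) (- k) * X k (lam ^+ 4)^-1)
  (K := e * J (t *+ 3) (- t) *
     \sum_k J (t *+ 3 + k) (- k) * J (t + k) (- (t *+ 2 + k)) * X k (lam ^+ 4)^-1) :
  N * (torus_count + 4%:R * curve_count + 6%:R * point_count) =
    q ^+ 3 - 1 + N * (12%:R * q * e * X (t *+ 2) (1 - lam ^+ 4)) + H + 3%:R * K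
  /\ (lam ^+ 4 = 1 -> K = N * (q * e)).
Proof.
by rewrite /H /K -dsum_coef_3F2_jac -dsum_coef_2F1_jac; split; [exact: total_count |
  exact: dsum_coef_2F1_at1].
Qed.

End GaussSums.

(** * Existence of a nontrivial additive character *)

(** The additive group of F is abelian with more than one element, hence has a nontrivial
    irreducible character, which is linear. *)
Lemma additive_character (F : finFieldType) : exists psi : F -> algC,
  [/\ forall x y, psi (x + y) = psi x * psi y, psi 0 = 1
    & forall z, \sum_x psi (z * x) = if z == 0 then #|F|%:R else 0].
Proof.
pose G := [set: F]%G.
have cG : abelian G by apply/centsP => x _ y _; apply: addrC.
have [i i0] : exists i : Iirr G, i != 0.
  apply/existsP; rewrite -negb_forall; apply/negP => /forallP all0.
  have := card_Iirr_abelian cG; rewrite cardsT.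
  have -> : #|Iirr G| = 1%N.
    by apply/eqP/fintype1P; exists 0 => i; apply/eqP.
  by move=> e; have := finNzRing_gt1 F; rewrite -e.
have lin : 'chi_i \is a linear_char by move/char_abelianP: cG.
have psiD x y : 'chi_i (x + y) = 'chi_i x * 'chi_i y.
  by rewrite -(lin_charM lin) ?inE.
have psi0 : 'chi_i (0 : F) = 1 by rewrite -(lin_char1 lin).
have [x0 hx0] : exists x0 : F, 'chi_i x0 != 1.
  apply/existsP; rewrite -negb_forall; apply: contra i0 => /forallP h.
  apply/eqP/irr_inj/cfunP => x; rewrite -[RHS]/('chi_0 x) irr0 cfun1E inE.
  exact/eqP.
exists 'chi_i; split=> // z; case: eqP => [->|/eqP z0].
  under eq_bigr => x _ do rewrite mul0r psi0.
  by rewrite sumr_const.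
transitivity (\sum_x 'chi_i x); first by rewrite [RHS](reindex_inj (mulfI z0)).
(* Translation by x0 multiplies the sum by a number other than 1, so the sum is 0. *)
have : 'chi_i x0 * \sum_x 'chi_i x = \sum_x 'chi_i x.
  rewrite [RHS](reindex_inj (addrI x0)) mulr_sumr.
  by apply: eq_bigr => x _; rewrite psiD.
move/eqP; rewrite -subr_eq0 -{2}[\sum_x _]mul1r -mulrBl mulf_eq0 subr_eq0.
by rewrite (negPf hx0) => /eqP.
Qed.

(** * Stratification of the projective surface *)

Lemma sum_ffun4 (F : finFieldType) (h : {ffun 'I_4 -> F} -> algC) :
  \sum_x h x =
  \sum_a \sum_b \sum_c \sum_d h [ffun i : 'I_4 => nth 0 [:: a; b; c; d] i].
Proof.
rewrite !pair_big /=.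
pose f (p : F * F * F * F) : {ffun 'I_4 -> F} :=
  [ffun i : 'I_4 => nth 0 [:: p.1.1.1; p.1.1.2; p.1.2; p.2] i].
pose g (x : {ffun 'I_4 -> F}) :=
  (x (inord 0), x (inord 1), x (inord 2), x (inord 3)).
rewrite (reindex f) //; exists g => [[[[a b] c] d] _|x _].
  by rewrite /g !ffunE !inordK.
apply/ffunP => i; rewrite ffunE; case: i => [[|[|[|[|m]]]] hm] //=;
  by congr (x _); apply: val_inj; rewrite /= inordK.
Qed.

Lemma sum_01 (F : finFieldType) (h : F -> algC) :
  (forall a, a != 0 -> a != 1 -> h a = 0) -> \sum_a h a = h 1 + h 0.
Proof.
move=> hz; rewrite (bigD1 1) //= (bigD1 0) 1?eq_sym ?oner_eq0 //= big1 ?addr0 //.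
by move=> a /andP[a1 a0]; apply: hz.
Qed.

Lemma normalized4E (F : finFieldType) (a b c d : F) :
  normalized [ffun i : 'I_4 => nth 0 [:: a; b; c; d] i] =
  (a == 1) || (a == 0) && ((b == 1) || (b == 0) && ((c == 1) ||
     (c == 0) && (d == 1))).
Proof.
apply/existsP/idP => [[[m hm]]|].
  rewrite ffunE => /andP[/= x1 /forallP x0].
  have get j (hj : (j < 4)%N) : (j < m)%N -> nth 0 [:: a; b; c; d] j == 0.
    by move=> jm; move: (x0 (Ordinal hj)); rewrite ffunE /= jm.
  case: m hm x1 get {x0} => [|[|[|[|m]]]] //= hm x1 get.
  - by rewrite x1.
  - by rewrite (get 0 isT isT) x1 orbT.
  - by rewrite (get 0 isT isT) (get 1 isT isT) x1 !orbT.
  - by rewrite (get 0 isT isT) (get 1 isT isT) (get 2 isT isT) x1 !orbT.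
have wit m (hm : (m < 4)%N) : nth 0 [:: a; b; c; d] m == 1 ->
    (forall j, (j < m)%N -> nth 0 [:: a; b; c; d] j == 0) ->
    exists i : 'I_4, ([ffun i : 'I_4 => nth 0 [:: a; b; c; d] i] i == 1) &&
      [forall j : 'I_4, (j < i)%N ==>
         ([ffun i : 'I_4 => nth 0 [:: a; b; c; d] i] j == 0)].
  move=> h1 h0; exists (Ordinal hm); rewrite ffunE h1 /=; apply/forallP => j.
  by apply/implyP; rewrite ffunE; apply: h0.
case/orP=> [a1|/andP[a0]]; first exact: (wit 0%N).
case/orP=> [b1|/andP[b0]]; first by apply: (wit 1%N) => // -[].
case/orP=> [c1|/andP[c0 d1]]; first by apply: (wit 2%N) => // -[|[]].
by apply: (wit 3%N) => // -[|[|[]]].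
Qed.

(** One coordinate can vanish in 4 ways and two in 6; a point with three zero coordinates is not on
    the surface. The sums arise by position of the leading 1, as 4 = 3 + 1 and 6 = 3 + 2 + 1. *)
Lemma dwork_count_strata (F : finFieldType) (lam : F) :
  (dwork_count lam)%:R =
  torus_count lam + 4%:R * curve_count F + 6%:R * point_count F :> algC.
Proof.
pose h a b c d : algC :=
  (a ^+ 4 + b ^+ 4 + c ^+ 4 + d ^+ 4 == 4%:R * lam * (a * b * c * d))%:R.
transitivity (\sum_a \sum_b \sum_c \sum_d
  ((a == 1) || (a == 0) && ((b == 1) || (b == 0) && ((c == 1) ||
     (c == 0) && (d == 1))))%:R * h a b c d).
  rewrite /dwork_count -sum1_card natr_sum big_mkcond sum_ffun4.
  do 4 (apply: eq_bigr => ? _).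
  rewrite inE normalized4E; rewrite !big_ord_recr !big_ord0 /= !ffunE /=.
  rewrite add0r mul1r /h; case: (_ || _) => //=; last by rewrite mul0r.
  by case: eqP; rewrite ?mul1r.
rewrite sum_01; last first.
  move=> a /negPf a0 /negPf a1; do 3 (rewrite big1 // => ? _).
  by rewrite a0 a1 mul0r.
rewrite eqxx [X in _ + X]sum_01; last first.
  move=> b /negPf b0 /negPf b1; do 2 (rewrite big1 // => ? _).
  by rewrite b0 b1 andbF eq_sym oner_eq0 mul0r.
rewrite eqxx [X in _ + (_ + X)]sum_01; last first.
  move=> c /negPf c0 /negPf c1; rewrite big1 // => ? _.
  by rewrite c0 c1 ![0 == 1]eq_sym oner_eq0 mul0r.
rewrite eqxx ![0 == 1]eq_sym oner_eq0 !eqxx /=.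
rewrite [X in _ + (_ + (_ + X))]sum_01; last first.
  by move=> d /negPf d0 /negPf d1; rewrite d1 mul0r.
rewrite eqxx ?mul0r ?addr0.
have h3 : h 0 0 0 1 = 0.
  by rewrite /h !expr0n /= expr1n !mul0r !mulr0 !add0r oner_eq0.
have h2 d : h 0 0 1 d = (1 + d ^+ 4 == 0)%:R.
  by rewrite /h !expr0n /= expr1n !mul0r !mulr0 !add0r.
have h1 c d : h 0 1 c d = (1 + c ^+ 4 + d ^+ 4 == 0)%:R.
  by rewrite /h !expr0n /= expr1n !mul0r !mulr0 !add0r.
have split0 (f : F -> algC) : \sum_x f x = f 0 + \sum_(x | x != 0) f x.
  by rewrite (bigD1 0).
have one0 : (1 + 0 ^+ 4 == 0 :> F) = false by rewrite expr0n addr0 oner_eq0.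
have E1 : \sum_(d : F) (1 + d ^+ 4 == 0)%:R = point_count F by rewrite split0 one0 add0r.
have E2 : \sum_(c : F) \sum_(d : F) (1 + c ^+ 4 + d ^+ 4 == 0)%:R = curve_count F + 2%:R
  * point_count F.
  rewrite split0 expr0n addr0 E1.
  under eq_bigr => c _ do rewrite split0 expr0n addr0.
  by rewrite big_split /= -/(point_count F) -/(curve_count F); ring.
have E3 : \sum_b \sum_c \sum_d h 1 b c d =
    torus_count lam + 3%:R * curve_count F + 3%:R * point_count F.
  have h0 c d : h 1 0 c d = (1 + c ^+ 4 + d ^+ 4 == 0)%:R.
    by rewrite /h expr1n expr0n !mulr0 !mul0r mulr0 addr0.
  have h0' b d : h 1 b 0 d = (1 + b ^+ 4 + d ^+ 4 == 0)%:R.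
    by rewrite /h expr1n expr0n !mulr0 !mul0r mulr0 addr0.
  have h0'' b c : h 1 b c 0 = (1 + b ^+ 4 + c ^+ 4 == 0)%:R.
    by rewrite /h expr1n expr0n !mulr0 addr0.
  have hT b c d : h 1 b c d =
      (1 + b ^+ 4 + c ^+ 4 + d ^+ 4 == 4%:R * lam * (b * c * d))%:R.
    by rewrite /h expr1n mul1r.
  rewrite split0; under eq_bigr => c _ do under eq_bigr => d _ do rewrite h0.
  rewrite E2.
  under eq_bigr => b _.
    rewrite split0; under eq_bigr => d _ do rewrite h0'.
    rewrite split0 expr0n addr0.
    under [X in _ + X]eq_bigr => c _ do rewrite split0 h0''.
    rewrite big_split /=.
    under [X in _ + (_ + X)]eq_bigr => c _ do under eq_bigr => d _ do rewrite hT.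
    over.
  rewrite !big_split /= -/(point_count F) -/(curve_count F) -/(torus_count lam).
  by ring.
rewrite [0 == 1]eq_sym oner_eq0 h3 mulr0 mul0r !addr0.
under eq_bigr => b _ do under eq_bigr => c _ do under eq_bigr => d _ do rewrite mul1r.
under [X in _ + (X + _)]eq_bigr => c _ do under eq_bigr => d _ do rewrite mul1r h1.
under [X in _ + (_ + X)]eq_bigr => d _ do rewrite mul1r h2.
by rewrite E1 E2 E3; ring.
Qed.

(** * The powers of T and Greene's functions in terms of them *)

Section CharacterGroup.

Variable F : finFieldType.

Lemma abelian_UG : abelian (UG F).
Proof. exact/cyclic_abelian/field_unit_group_cyclic. Qed.

Lemma irr_UG_lin (i : Iirr (UG F)) : 'chi_i \is a linear_char.
Proof. by move/char_abelianP: abelian_UG. Qed.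

Lemma card_UG : #|UG F| = #|F|.-1.
Proof.
rewrite cardsT card_sub; apply/esym/eqP; rewrite -(cardC1 (0 : F)).
by apply/eqP/eq_card => x; rewrite !inE unitfE.
Qed.

Lemma cext0 (chi : 'CF(UG F)) : cext chi 0 = 0.
Proof. by rewrite /cext insubN // unitr0. Qed.

Lemma cext_val (chi : 'CF(UG F)) (u : {unit F}) : cext chi (val u) = chi u.
Proof. by rewrite /cext valK. Qed.

Lemma cext_unitP (x : F) : x != 0 -> exists u : {unit F}, x = val u.
Proof. by rewrite -unitfE => ux; exists (FinRing.unit F ux). Qed.

Lemma cextM chi (x y : F) : chi \is a linear_char ->
  cext chi (x * y) = cext chi x * cext chi y.
Proof.
move=> lin; have [->|/cext_unitP[u ->]] := eqVneq x 0.
  by rewrite mul0r cext0 mul0r.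
have [->|/cext_unitP[v ->]] := eqVneq y 0; first by rewrite mulr0 cext0 mulr0.
by rewrite -FinRing.val_unitM !cext_val lin_charM ?inE.
Qed.

Lemma cext1 chi : chi \is a linear_char -> cext chi (1 : F) = 1.
Proof. by move=> lin; rewrite -FinRing.val_unit1 cext_val lin_char1. Qed.

Lemma cext_exp (chi : 'CF(UG F)) m x : x != 0 -> cext (chi ^+ m) x = cext chi x ^+ m.
Proof. by case/cext_unitP=> u ->; rewrite !cext_val exp_cfunE ?inE. Qed.

Variable T : Iirr (UG F).
Hypothesis hT : forall i : Iirr (UG F), exists k : nat, 'chi_i = 'chi_T ^+ k.
Hypothesis card_gt2 : (1 < #|F|.-1)%N.

Local Notation n := #|F|.-1.

(** The case x = 0 is explicit because 0^0 = 1 would give the trivial character the value 1 at 0. *)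
Definition power_char (k : 'Z_n) (x : F) : algC :=
  if x == 0 then 0 else cext 'chi_T x ^+ k.

Local Notation X := power_char.

Lemma card_FS : #|F| = n.+1.
Proof. by rewrite prednK //; apply/card_gt0P; exists 0. Qed.

Lemma cext_gen_order x : x != 0 -> cext 'chi_T x ^+ n = 1.
Proof.
case/cext_unitP=> u ->; rewrite cext_val -lin_charX ?inE ?irr_UG_lin //.
by rewrite -card_UG expg_cardG ?inE // lin_char1 ?irr_UG_lin.
Qed.

(** Every irreducible character is a power of T, so an element of the kernel of T lies in all
    kernels, whose intersection is trivial. *)
Lemma cext_gen_inj x : x != 0 -> cext 'chi_T x = 1 -> x = 1.
Proof.
case/cext_unitP=> u ->; rewrite cext_val => Tu.
suff : u \in \bigcap_i cfker 'chi[UG F]_i by rewrite TI_cfker_irr => /set1P ->.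
apply/bigcapP => i _; rewrite cfkerEirr inE lin_char1 ?irr_UG_lin //.
by have [k ->] := hT i; rewrite exp_cfunE ?inE // Tu expr1n.
Qed.

Lemma Zn_cast : (Zp_trunc n).+2 = n.
Proof. exact: Zp_cast. Qed.

Lemma power_char0 k : X k 0 = 0.
Proof. by rewrite /power_char eqxx. Qed.

Lemma power_char1 k : X k 1 = 1.
Proof. by rewrite /power_char oner_eq0 cext1 ?irr_UG_lin // expr1n. Qed.

Lemma power_charM k x y : X k (x * y) = X k x * X k y.
Proof.
rewrite /power_char mulf_eq0; case: eqP => _; first by rewrite mul0r.
by case: eqP => _; rewrite ?mulr0 // cextM ?irr_UG_lin // exprMn.
Qed.

Lemma power_charD k l x : X (k + l) x = X k x * X l x.
Proof.
rewrite /power_char; case: eqP => [|/eqP x0]; first by rewrite mul0r.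
rewrite -exprD /= [X in (_ %% X)%N]Zn_cast.
by rewrite expr_mod ?cext_gen_order.
Qed.

Lemma triv_power_char x : x != 0 -> X 0 x = 1.
Proof. by rewrite /power_char => /negPf ->. Qed.

Lemma cext_power_char m x : cext ('chi_T ^+ m) x = X m%:R x.
Proof.
rewrite /power_char; case: eqP => [->|/eqP x0]; first exact: cext0.
by rewrite cext_exp // val_Zp_nat // expr_mod ?cext_gen_order.
Qed.

(** Any generator of the cyclic unit group works: T is injective on units, so T(u)^k = 1 forces n to
    divide k. *)
Lemma power_char_gen : exists2 u : F, u != 0 & forall k, X k u = 1 -> k = 0.
Proof.
have /cyclicP[u defU] := field_unit_group_cyclic (UG F).
have u0 : val u != 0 by rewrite -unitfE (valP u).
exists (val u) => // k; rewrite /power_char (negPf u0) cext_val.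
rewrite -lin_charX ?inE ?irr_UG_lin // -cext_val => /cext_gen_inj.
rewrite -unitfE (valP (u ^+ k)%g) => /(_ isT); rewrite -FinRing.val_unit1 => /val_inj/eqP.
rewrite -order_dvdn orderE -defU card_UG => dvd.
apply/eqP; rewrite -val_eqE /=; case: posnP => // k0; move: (dvdn_leq k0 dvd).
by rewrite leqNgt -[X in (_ < X)%N]Zn_cast ltn_ord.
Qed.

Lemma sum_power_char k : \sum_x X k x = if k == 0 then n%:R else 0.
Proof.
case: eqP => [->|/eqP k0].
  rewrite (bigD1 0) //= power_char0 add0r.
  under eq_bigr => x x0 do rewrite triv_power_char //.
  by rewrite sumr_const cardC1.
have [u u0 hu] := power_char_gen.
have : X k u * \sum_x X k x = \sum_x X k x.
  rewrite [RHS](reindex_inj (mulfI u0)) mulr_sumr.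
  by apply: eq_bigr => x _; rewrite power_charM.
move/eqP; rewrite -subr_eq0 -{2}[\sum_x _]mul1r -mulrBl mulf_eq0 subr_eq0.
case/orP=> [/eqP/hu ek|/eqP //]; by rewrite ek eqxx in k0.
Qed.

Lemma sum_power_char_dual x : \sum_k X k x = if x == 1 then n%:R else 0.
Proof.
case: eqP => [->|x1].
  under eq_bigr => k _ do rewrite power_char1.
  by rewrite sumr_const card_ord Zn_cast.
have [->|x0] := eqVneq x 0; first by rewrite big1 // => k _; rewrite power_char0.
have : X 1 x * \sum_k X k x = \sum_k X k x.
  rewrite [RHS](reindex_inj (addrI 1)) mulr_sumr.
  by apply: eq_bigr => k _; rewrite power_charD.
move/eqP; rewrite -subr_eq0 -{2}[\sum_x _]mul1r -mulrBl mulf_eq0 subr_eq0.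
case/orP=> [|/eqP //]; rewrite /power_char (negPf x0) /= expr1.
by move/eqP/(cext_gen_inj x0)/x1.
Qed.

(** The map k -> T^k is injective, and an abelian group has as many irreducible characters as
    elements, so it is a bijection. *)
Lemma sum_Iirr_power (f : 'CF(UG F) -> algC) :
  \sum_(i : Iirr (UG F)) f 'chi_i = \sum_(k : 'Z_n) f ('chi_T ^+ k).
Proof.
have linX m : 'chi_T ^+ m \in irr (UG F).
  by apply/lin_char_irr/rpredX/irr_UG_lin.
pose g (k : 'Z_n) := cfIirr ('chi_T ^+ k).
have gE k : 'chi_(g k) = 'chi_T ^+ k by rewrite cfIirrE.
have inj_g : injective g.
  move=> k l e; have [u u0 hu] := power_char_gen.
  apply/eqP; rewrite -subr_eq0; apply/eqP/hu; rewrite power_charD.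
  have -> : X k u = X l u.
    by rewrite /power_char (negPf u0) -!cext_exp // -!gE e.
  by rewrite -power_charD subrr triv_power_char.
rewrite (reindex g); first by apply: eq_bigr => k _; rewrite gE.
apply/onW_bij/(inj_card_bij inj_g).
by rewrite card_Iirr_abelian ?abelian_UG // card_UG card_ord Zn_cast.
Qed.

Lemma jacobi_power m l : jacobi ('chi_T ^+ m) ('chi_T ^+ l) =
  X l%:R (-1) / #|F|%:R * jac X m%:R (- l%:R).
Proof.
rewrite /jacobi cext_power_char; congr (_ * _); apply: eq_bigr => x _.
rewrite cext_power_char /cinv cext_power_char; congr (_ * _).
have [->|x0] := eqVneq (1 - x) 0; first by rewrite !power_char0 invr0.
have := power_charD l%:R (- l%:R) (1 - x); rewrite subrr triv_power_char //.
move=> e; have X0 : X l%:R (1 - x) != 0.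
  by apply: contra_eq_neq e => ->; rewrite mul0r oner_eq0.
by apply: (mulfI X0); rewrite divff.
Qed.

Lemma power_charN1_sq k : X k (-1) ^+ 2 = 1.
Proof. by rewrite expr2 -power_charM mulrNN mulr1 power_char1. Qed.

Local Notation q := (#|F|%:R : algC).
Local Notation N := (n%:R : algC).
Local Notation J := (jac X).

Lemma card_neq0 : q != 0.
Proof. by rewrite card_FS pnatr_eq0. Qed.

Lemma card_pred_neq0 : N != 0.
Proof. by rewrite pnatr_eq0 -lt0n ltnW. Qed.

(** The three factors 1/q from the Jacobi sums and the prefactor q/(q - 1) leave 1/N after
    multiplication by q^2; the three signs T^k(-1) reduce to one. *)
Lemma greene32_power m0 m1 m2 x :
  q ^+ 2 * greene32 ('chi_T ^+ m0) ('chi_T ^+ m1) ('chi_T ^+ m2) 1 1 x =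
  (\sum_k X k (-1) * J (m0%:R + k) (- k) * J (m1%:R + k) (- k)
     * J (m2%:R + k) (- k) * X k x) / N.
Proof.
rewrite /greene32 (sum_Iirr_power (fun chi => jacobi ('chi_T ^+ m0 * chi) chi
  * jacobi ('chi_T ^+ m1 * chi) (1 * chi) * jacobi ('chi_T ^+ m2 * chi) (1 * chi)
  * cext chi x)) mulrA mulr_sumr mulr_suml; apply: eq_bigr => k _.
rewrite mul1r -!exprD !jacobi_power cext_power_char !natrD natr_Zp.
have q0 := card_neq0; have N0 := card_pred_neq0.
transitivity (X k (-1) ^+ 2 * X k (-1) * J (m0%:R + k) (- k) * J (m1%:R + k) (- k)
     * J (m2%:R + k) (- k) * X k x / N); last by rewrite power_charN1_sq mul1r.
by field; apply/andP.
Qed.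

Lemma greene21_power m0 m1 l x :
  q * greene21 ('chi_T ^+ m0) ('chi_T ^+ m1) ('chi_T ^+ l) x =
  X l%:R (-1) * (\sum_k J (m0%:R + k) (- k) * J (m1%:R + k) (- (l%:R + k)) * X k x) / N.
Proof.
rewrite /greene21 (sum_Iirr_power (fun chi => jacobi ('chi_T ^+ m0 * chi) chi
  * jacobi ('chi_T ^+ m1 * chi) ('chi_T ^+ l * chi)
  * cext chi x)) mulrA !mulr_sumr mulr_suml; apply: eq_bigr => k _.
rewrite -!exprD !jacobi_power cext_power_char !natrD natr_Zp power_charD.
have q0 := card_neq0; have N0 := card_pred_neq0.
transitivity (X k (-1) ^+ 2 * (X l%:R (-1) * (J (m0%:R + k) (- k)
  * J (m1%:R + k) (- (l%:R + k)) * X k x)) / N); last by rewrite power_charN1_sq mul1r.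
by field; apply/andP.
Qed.

End CharacterGroup.

(** * Assembly of the point count *)

Theorem theorem1 (F : finFieldType) (p e : nat)
  (hp : prime p) (hodd : odd p) (hcard : #|F| = (p ^ e)%N)
  (hq4 : (#|F| %% 4 = 1)%N)
  (T : Iirr (UG F))
  (hT : forall i : Iirr (UG F), exists k : nat, 'chi_i = 'chi_T ^+ k)
  (lam : F) (hlam : lam != 0) :
  let q : algC := #|F|%:R in
  let t : nat := ((#|F| - 1) %/ 4)%N in
  let Tt := 'chi_T ^+ t in
  let T2t := 'chi_T ^+ (2 * t) in
  let T3t := 'chi_T ^+ (3 * t) in
  (dwork_count lam)%:R =
     (q ^+ 3 - 1) / (q - 1)
     + 12%:R * q * cext Tt (-1) * cext T2t (1 - lam ^+ 4)
     + q ^+ 2 * greene32 Tt T2t T3t 1 1 (lam ^+ 4)^-1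
     + 3%:R * q ^+ 2 * jacobi T3t Tt * greene21 T3t Tt T2t (lam ^+ 4)^-1
  /\
  (lam ^+ 4 = 1 ->
   (dwork_count lam)%:R =
     (q ^+ 3 - 1) / (q - 1)
     + 3%:R * q * cext Tt (-1)
     + q ^+ 2 * greene32 Tt T2t T3t 1 1 1).
Proof.
move=> q t Tt T2t T3t.
have F1 : (1 < #|F|)%N := finNzRing_gt1 F.
have nE : (#|F|.-1 = t * 4)%N.
  rewrite /t -subn1 {1}(divn_eq (#|F| - 1) 4).
  have := divn_eq #|F| 4; rewrite hq4 => ->.
  by rewrite addnK mulnK // modnMl addn0.
have t_gt0 : (0 < t)%N.
  by move: nE F1; case: (#|F|) => [|[|m]] //=; case: (t).
have n_gt1 : (1 < #|F|.-1)%N by rewrite nE (leq_trans _ (leq_pmull 4 t_gt0)).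
have two0 : (2%:R : F) != 0.
  have pF := card_finPcharP hcard hp.
  rewrite -(dvdn_pcharf pF); apply: contraL hodd.
  by move/(@dvdn_leq p 2 isT); case: p hp {hcard pF} => [|[|[]]].
pose s : 'Z_(#|F|.-1) := t%:R.
have natZ m : (m%:R == 0 :> 'Z_(#|F|.-1)) = (t * 4 %| m)%N.
  by rewrite -val_eqE /= val_Zp_nat // -nE.
have sM m : s *+ m = (t * m)%:R by rewrite natrM mulr_natr.
have s4 : s *+ 4 = 0 by apply/eqP; rewrite sM natZ.
have s2 : s *+ 2 != 0.
  by rewrite sM natZ dvdn_pmul2l.
have tors k : k *+ 4 = 0 -> k \in [:: 0; s; s *+ 2; s *+ 3].
  (* Since n = 4t, the condition 4k = 0 modulo n says that t divides the representative k < 4t. *)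
  rewrite -{1}[k]natr_Zp -mulrnA => /eqP; rewrite natZ dvdn_pmul2r //.
  case/dvdnP=> j kE; have := ltn_ord k.
  rewrite [X in (_ < X)%N]Zp_cast // [X in (_ < X)%N]nE kE mulnC ltn_pmul2l //
    -[k]natr_Zp kE mulnC -sM.
  by case: j kE => [|[|[|[|//]]]] _ _; rewrite !inE ?mulr0n ?mulr1n eqxx ?orbT.
have [psi [psiD psi0 sum_psi]] := additive_character F.
have [cnt at1] := count_formula (card_FS F) n_gt1 (@power_char0 F T)
  (@power_char1 F T) (@power_charM F T) (power_charD T n_gt1)
  (@triv_power_char F T) (sum_power_char hT n_gt1) (sum_power_char_dual hT n_gt1)
  psiD psi0 sum_psi s4 s2 tors two0 hlam.
have q0 : q != 0 := card_neq0 F.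
have N0 : (#|F|.-1)%:R != 0 :> algC := card_pred_neq0 n_gt1.
have qE : q = (#|F|.-1)%:R + 1 by rewrite /q {1}card_FS -natr1.
have q1 : q - 1 = (#|F|.-1)%:R by rewrite qE addrK.
have m2 : (2 * t)%:R = s *+ 2 by rewrite sM mulnC.
have m3 : (3 * t)%:R = s *+ 3 by rewrite sM mulnC.
have cT x : cext Tt x = power_char T s x by rewrite cext_power_char.
have cT2 x : cext T2t x = power_char T (s *+ 2) x by rewrite cext_power_char // m2.
have g32 := greene32_power hT n_gt1 t (2 * t) (3 * t) (lam ^+ 4)^-1.
have g21 := greene21_power hT n_gt1 (3 * t) t (2 * t) (lam ^+ 4)^-1.
rewrite m2 m3 -/Tt -/T2t -/T3t -/s -/q in g32 g21.
have jac31 : q * jacobi T3t Tt =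
    power_char T s (-1) * jac (power_char T) (s *+ 3) (- s).
  by rewrite jacobi_power // m3 -/s -/q mulrA [q * _]mulrC mulfVK.
have X2 : power_char T (s *+ 2) (-1) = 1.
  by rewrite mulr2n power_charD // -expr2 power_charN1_sq.
rewrite X2 mul1r in g21.
have cnt' : (dwork_count lam)%:R = (q ^+ 3 - 1) / (q - 1)
     + 12%:R * q * cext Tt (-1) * cext T2t (1 - lam ^+ 4)
     + q ^+ 2 * greene32 Tt T2t T3t 1 1 (lam ^+ 4)^-1
     + 3%:R * q ^+ 2 * jacobi T3t Tt * greene21 T3t Tt T2t (lam ^+ 4)^-1.
  (* One factor q goes to the binomial coefficient and one to the 2F1. *)
  have -> : 3%:R * q ^+ 2 * jacobi T3t Tt * greene21 T3t Tt T2t (lam ^+ 4)^-1 =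
     3%:R * (q * jacobi T3t Tt) * (q * greene21 T3t Tt T2t (lam ^+ 4)^-1) by ring.
  rewrite g32 g21 jac31 cT cT2 dwork_count_strata q1; apply: (mulfI N0).
  by rewrite cnt; field.
(* At lam^4 = 1 the quadratic term vanishes because T^2t(0) = 0, and the 2F1 term becomes 3q
   T^t(-1). *)
split=> // l1; rewrite cnt' l1 subrr cT2 power_char0 mulr0 addr0 invr1.
have -> : 3%:R * q ^+ 2 * jacobi T3t Tt * greene21 T3t Tt T2t 1 =
  3%:R * (q * jacobi T3t Tt) * (q * greene21 T3t Tt T2t 1) by ring.
move: (at1 l1) g21; rewrite -jac31 l1 invr1 => K -> .
have shuffle (A S : algC) : 3%:R * A * (S / (#|F|.-1)%:R) = 3%:R * (A * S) / (#|F|.-1)%:R.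
  by ring.
by rewrite shuffle K cT q1; field.
Qed.
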